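(* Let $\lambda<\mu$, where $\lambda$ is an infinite cardinal and $\mu$ is a cardinal or $\infty$. Let $\mathfrak{s}$ be a good ess-$[\lambda,\mu)$-frame and let $\mathbb{E}$ be a small smooth $\mathfrak{k}_{\mathfrak s}$-equivalence relation. Let $\mathfrak{s}\langle\mathbb{E}\rangle$ be as defined in the context. (1) $\mathfrak{s}\langle\mathbb{E}\rangle$ is a good ess-$[\lambda,\mu)$-frame. (2) For every cardinal $\kappa$, the number of models of cardinality $\kappa$ up to isomorphism is the same in $K_{\mathfrak{s}\langle\mathbb{E}\rangle}$ and in $K_{\mathfrak s}$, i.e. $\dot I(\kappa,K_{\mathfrak{s}\langle\mathbb{E}\rangle})=\dot I(\kappa,K_{\mathfrak s})$. (3) If $\mathfrak{s}$ has primes, then $\mathfrak{s}\langle\mathbb{E}\rangle$ has primes; likewise, if $\mathfrak{s}$ has regulars, then $\mathfrak{s}\langle\mathbb{E}\rangle$ has regulars.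
   Context: **Ess-$[\lambda,\mu)$-a.e.c.** This is an object $\mathfrak{k}$ consisting of a vocabulary $\tau$ whose symbols have possibly infinite arity, but arity $\le\lambda$; a class $K=K_{\mathfrak k}$ of $\tau$-models; and a relation $\le_{\mathfrak k}$ on $K$ with $M\le_{\mathfrak k}N\Rightarrow M\subseteq N$, such that ($|M|$ is the universe, $\|M\|$ its cardinality): - $K$ and $\le_{\mathfrak k}$ are closed under isomorphism; every $M\in K$ has $\|M\|\in[\lambda,\mu)$; $\le_{\mathfrak k}$ is a partial order; - if $\delta$ is limit, $\langle M_i:i<\delta\rangle$ is $\le_{\mathfrak k}$-increasing and $|\bigcup_i|M_i||<\mu$, there is a unique $M\in K$ with universe $\bigcup_i|M_i|$ and all $M_i\le_{\mathfrak k}M$ (the union); and if all $M_i\le_{\mathfrak k}N$ then $M\le_{\mathfrak k}N$; - if $M_1\subseteq M_2$ and $M_1,M_2\le_{\mathfrak k}N$ then $M_1\le_{\mathfrak k}M_2$; - if $A\subseteq N\in K$ there is $M$ with $A\subseteq M\le_{\mathfrak k}N$, $\|M\|\le\lambda+|A|$. ''Increasing continuous'' means $\le_{\mathfrak k}$-increasing with unions (in this sense) at limits. A $\le_{\mathfrak k}$-embedding of $M$ into $N$ is an isomorphism onto some $M'\le_{\mathfrak k}N$. $K_\chi=\{M\in K:\|M\|=\chi\}$. **Orbital types.** For $M\le_{\mathfrak k}N$ and $a\in N$, $\mathrm{ortp}(a,M,N)$ is the class of $(M,N,a)$ under the transitive closure of the relation: $(M,N_1,a_1)\sim(M,N_2,a_2)$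 iff there are $N\in K$ and $\le_{\mathfrak k}$-embeddings $f_\ell:N_\ell\to N$ over $M$ with $f_1(a_1)=f_2(a_2)$. $\mathcal{S}(M)$ is the set of all $\mathrm{ortp}(a,M,N)$. For $M\le_{\mathfrak k}M'$ and $p=\mathrm{ortp}(a,M',N)$, $p\restriction M=\mathrm{ortp}(a,M,N)$. **Good ess-$[\lambda,\mu)$-frame.** $\mathfrak{s}$ consists of an ess-$[\lambda,\mu)$-a.e.c. $\mathfrak{k}_{\mathfrak s}=(K_{\mathfrak s},\le_{\mathfrak s})$, a class $\mathcal{S}^{\mathrm{bs}}_{\mathfrak s}$ of (basic) types and a 4-place relation $\bigcup_{\mathfrak s}$ (non-forking), such that: - (B) for every $\chi\in[\lambda,\mu)$ there is a superlimit model $M^*$ in $K_\chi$: $M^*\in K_\chi$; every $M_1\in K_\chi$ has some $M_2\cong M^*$ with $M_1<_{\mathfrak s}M_2\in K_\chi$; and if $\delta<\chi^+$ is limit and $\langle M_i:i<\delta\rangle$ is $\le_{\mathfrak s}$-increasing with all $M_i\cong M^*$, then its union is isomorphic to $M^*$. Moreover there are at most $2^\lambda$ models in $K_\lambda$ up to isomorphism; - (C) $\mathfrak{k}_{\mathfrak s}$ has amalgamation, joint embedding and no $\le_{\mathfrak s}$-maximal member; - (D) $\mathcal{S}^{\mathrm{bs}}_{\mathfrak s}(M)\subseteq\mathcal{S}(M)$ for $M\in K_{\mathfrak s}$, invariant under isomorphisms; basic types are non-algebraic (not realized in $M$); density: if $M\le_{\mathfrak s}N$, $M\ne N$ then some $a\in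 N\setminus M$ has $\mathrm{ortp}(a,M,N)\in\mathcal{S}^{\mathrm{bs}}_{\mathfrak s}(M)$; stability: $|\mathcal{S}^{\mathrm{bs}}_{\mathfrak s}(M)|\le\|M\|$; - (E)(a) $\bigcup_{\mathfrak s}(M_0,M_1,a,M_3)$ is invariant under isomorphisms and implies $M_0\le_{\mathfrak s}M_1\le_{\mathfrak s}M_3$, $a\in M_3\setminus M_1$, and $\mathrm{ortp}(a,M_i,M_3)\in\mathcal{S}^{\mathrm{bs}}_{\mathfrak s}(M_i)$ for $i=0,1$; if $M_0=M_1\le_{\mathfrak s}M_3$, it is equivalent to $\mathrm{ortp}(a,M_0,M_3)\in\mathcal{S}^{\mathrm{bs}}_{\mathfrak s}(M_0)$; - (E)(b) monotonicity: if $M_0\le_{\mathfrak s}M_0'\le_{\mathfrak s}M_1'\le_{\mathfrak s}M_1\le_{\mathfrak s}M_3\le_{\mathfrak s}M_3'$ and $M_1\cup\{a\}\subseteq M_3''\le_{\mathfrak s}M_3'$, then $\bigcup_{\mathfrak s}(M_0,M_1,a,M_3)\Rightarrow\bigcup_{\mathfrak s}(M_0',M_1',a,M_3')\Leftrightarrow\bigcup_{\mathfrak s}(M_0',M_1',a,M_3'')$; so one says ''$\mathrm{ortp}(a,M_1,M_3)$ does not fork over $M_0$''; - (E)(c) local character: if $\delta$ is limit, $\langle M_i:i\le\delta\rangle$ is increasing continuous and $p\in\mathcal{S}^{\mathrm{bs}}_{\mathfrak s}(M_\delta)$, then $p$ does not fork over $M_i$ for some $i<\delta$; - (E)(d) transitivity: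 if $M_0\le_{\mathfrak s}M_0'\le_{\mathfrak s}M_0''\le_{\mathfrak s}M_3$, $a\in M_3$, $\mathrm{ortp}(a,M_0'',M_3)$ does not fork over $M_0'$ and $\mathrm{ortp}(a,M_0',M_3)$ does not fork over $M_0$, then $\mathrm{ortp}(a,M_0'',M_3)$ does not fork over $M_0$; - (E)(e) uniqueness: if $p,q\in\mathcal{S}^{\mathrm{bs}}_{\mathfrak s}(M_1)$ do not fork over $M_0$ and $p\restriction M_0=q\restriction M_0$ then $p=q$; - (E)(f) symmetry: if $M_0\le_{\mathfrak s}M_3$, $a_\ell\in M_3$ and $\mathrm{ortp}(a_\ell,M_0,M_3)\in\mathcal{S}^{\mathrm{bs}}_{\mathfrak s}(M_0)$ for $\ell=1,2$, then the following are equivalent: there are $M_1,M_3'$ with $M_0\le_{\mathfrak s}M_1\le_{\mathfrak s}M_3'$, $a_1\in M_1$, $M_3\le_{\mathfrak s}M_3'$ and $\mathrm{ortp}(a_2,M_1,M_3')$ not forking over $M_0$; there are $M_2,M_3'$ with $M_0\le_{\mathfrak s}M_2\le_{\mathfrak s}M_3'$, $a_2\in M_2$, $M_3\le_{\mathfrak s}M_3'$ and $\mathrm{ortp}(a_1,M_2,M_3')$ not forking over $M_0$; - (E)(g) existence: if $M\le_{\mathfrak s}N$ and $p\in\mathcal{S}^{\mathrm{bs}}_{\mathfrak s}(M)$, some $q\in\mathcal{S}^{\mathrm{bs}}_{\mathfrak s}(N)$ extends $p$ and does not fork over $M$; - (E)(h) continuity: if $\delta$ is limit, $\langle M_i:i\le\delta\rangle$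 is increasing continuous, $p\in\mathcal{S}(M_\delta)$ and $p\restriction M_i$ does not fork over $M_0$ for all $i<\delta$, then $p\in\mathcal{S}^{\mathrm{bs}}_{\mathfrak s}(M_\delta)$ and $p$ does not fork over $M_0$. **Primes.** $K^{3,\mathrm{pr}}_{\mathfrak s}$ is the class of triples $(M,N,a)$ such that $M\le_{\mathfrak s}N$, $a\in N$, $\mathrm{ortp}(a,M,N)\in\mathcal{S}^{\mathrm{bs}}_{\mathfrak s}(M)$, and whenever $M\le_{\mathfrak s}N'$, $a'\in N'$ and $\mathrm{ortp}(a',M,N')=\mathrm{ortp}(a,M,N)$, there is a $\le_{\mathfrak s}$-embedding of $N$ into $N'$ which is the identity on $M$ and maps $a$ to $a'$. $\mathfrak{s}$ has primes if for every $M\in K_{\mathfrak s}$ and $p\in\mathcal{S}^{\mathrm{bs}}_{\mathfrak s}(M)$ there are $N,a$ with $(M,N,a)\in K^{3,\mathrm{pr}}_{\mathfrak s}$ and $\mathrm{ortp}(a,M,N)=p$. **Regulars.** Types $p_1,p_2\in\mathcal{S}^{\mathrm{bs}}_{\mathfrak s}(M_0)$ are weakly orthogonal if whenever $M_0\le_{\mathfrak s}M_\ell\le_{\mathfrak s}M_3$, $(M_0,M_\ell,a_\ell)\in K^{3,\mathrm{pr}}_{\mathfrak s}$ and $\mathrm{ortp}(a_\ell,M_0,M_\ell)=p_\ell$ for $\ell=1,2$, the type $\mathrm{ortp}(a_2,M_1,M_3)$ does not fork over $M_0$. Basic types $p_1,p_2$ over models $M_1,M_2$ are orthogonal if for every $N$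 with $M_1,M_2\le_{\mathfrak s}N$ their non-forking extensions in $\mathcal{S}^{\mathrm{bs}}_{\mathfrak s}(N)$ are weakly orthogonal. A type $p\in\mathcal{S}^{\mathrm{bs}}_{\mathfrak s}(M)$ is regular if it is orthogonal to each of its forking extensions, i.e. to every $q\in\mathcal{S}^{\mathrm{bs}}_{\mathfrak s}(N)$ with $M\le_{\mathfrak s}N$, $q\restriction M=p$, such that $q$ forks over $M$. $\mathfrak{s}$ has regulars if whenever $M\le_{\mathfrak s}N$ and $M\neq N$ there is $c\in N\setminus M$ such that $\mathrm{ortp}(c,M,N)$ is a (basic) regular type. For $\mathfrak{s}\langle\mathbb{E}\rangle$ the notions are defined in the same way. **Smooth equivalence relation.** $\mathrm{seq}(M)=\{\bar a\in{}^\lambda M:M\restriction\mathrm{Rang}(\bar a)\le_{\mathfrak k}M\}$. A smooth $\mathfrak{k}$-equivalence relation is a function $M\mapsto\mathbb{E}_M$ on $K_{\mathfrak k}$ such that: $\mathbb{E}_M$ is an equivalence relation on a subset $\mathrm{Dom}(\mathbb{E}_M)$ of $\mathrm{seq}(M)$; if $M_1\le_{\mathfrak k}M_2$ then $\mathbb{E}_{M_2}\restriction\mathrm{seq}(M_1)=\mathbb{E}_{M_1}$; isomorphisms $M_1\to M_2$ carry $\mathbb{E}_{M_1}$ to $\mathbb{E}_{M_2}$; and if $\langle M_\alpha:\alpha\le\delta\rangle$ is increasing continuous with $\delta$ limit, every $\mathbb{E}_{M_\delta}$-class has a member in $\bigcup_{\alpha<\delta}\mathrm{Dom}(\mathbb{E}_{M_\alpha})$.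 It is small if each $\mathbb{E}_M$ has at most $\|M\|$ classes. **The class $\mathfrak{k}\langle\mathbb{E}\rangle$.** The vocabulary is $\tau\cup\{F_*,c_*,P_*\}$ with new symbols: $F_*$ a $\lambda$-place function symbol, $c_*$ a constant, $P_*$ a unary predicate. $K_{\mathfrak{k}\langle\mathbb{E}\rangle}$ is the class of models $M^*$ such that for some $M\in K_{\mathfrak k}$ (the witness of $M^*$): $|M|=P_*^{M^*}$; $R^{M^*}=R^M$ for predicates $R\in\tau$; for function symbols $F\in\tau$, $F^{M^*}$ extends $F^M$ and takes value $c_*^{M^*}$ on tuples not from $M$; $c_*^{M^*}\notin|M|$; $F_*^{M^*}$ maps $\mathrm{Dom}(\mathbb{E}_M)$ onto $|M^*|\setminus|M|\setminus\{c_*^{M^*}\}$, with $F_*^{M^*}(\bar a)=F_*^{M^*}(\bar b)\Leftrightarrow\bar a\,\mathbb{E}_M\,\bar b$ for $\bar a,\bar b\in\mathrm{Dom}(\mathbb{E}_M)$, and takes value $c_*^{M^*}$ on all other $\lambda$-tuples of $M^*$. $M^*\le_{\mathfrak{k}\langle\mathbb{E}\rangle}N^*$ iff $M^*\subseteq N^*$ and the witnesses satisfy $M\le_{\mathfrak k}N$. **The frame $\mathfrak{t}=\mathfrak{s}\langle\mathbb{E}\rangle$.** $\mathfrak{k}_{\mathfrak t}=\mathfrak{k}_{\mathfrak s}\langle\mathbb{E}\rangle$. $\mathcal{S}^{\mathrm{bs}}_{\mathfrak t}(M^* )$ is the set of $\mathrm{ortp}_{\mathfrak{k}_{\mathfrak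 t}}(a,M^*,N^* )$ such that $M^*\le_{\mathfrak{k}_{\mathfrak t}}N^*$ with witnesses $M\le_{\mathfrak s}N$, $a\in N\setminus M$ and $\mathrm{ortp}_{\mathfrak s}(a,M,N)\in\mathcal{S}^{\mathrm{bs}}_{\mathfrak s}(M)$. Non-forking is defined similarly: $\bigcup_{\mathfrak t}(M_0^*,M_1^*,a,M_3^* )$ iff $M_0^*\le_{\mathfrak{k}_{\mathfrak t}}M_1^*\le_{\mathfrak{k}_{\mathfrak t}}M_3^*$ with witnesses $M_0,M_1,M_3$ satisfying $\bigcup_{\mathfrak s}(M_0,M_1,a,M_3)$. *)

(* Defs.v *)
From Stdlib Require Import Relation_Operators.
From mathcomp Require Import all_boot.
From mathcomp Require Import boolp classical_sets functions cardinality.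

Set Implicit Arguments.
Unset Strict Implicit.
Unset Printing Implicit Defensive.

Local Open Scope classical_set_scope.
Local Open Scope card_scope.

(* Small types play the role of the sets of set theory.  A cardinal is given
   by a small type of that cardinality, so that cardinals are compared with
   #<= and #= and never with =. *)
Definition Small : Type := Type.

(* The class of all possible elements of models: well-founded trees with small
   branching, i.e. codes for sets.  What matters is that this is a proper
   class: outside any small set of elements there is room for a copy of any
   small type. *)
Inductive V : Type := node (A : Small) (f : A -> V).

Definition card_lt (T U : Type) (A : set T) (B : set U) : Prop :=
  A #<= B /\ ~ (B #<= A).

(* An upper bound mu on cardinals is Some m, or None for infinity. *)
Definition card_below (mu : option Small) (T : Type) (A : set T) : Prop :=
  match mu with
  | Some m => card_lt A [set: m]
  | None => exists k : Small, A #= [set: k]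
  end.

Section Models.

Record vocabulary := Vocabulary {
  predsym : Small;
  funsym : Small;
  parity : predsym -> Small;
  farity : funsym -> Small
}.

Definition tuple_in (I : Small) (A : set V) (t : I -> V) : Prop :=
  forall i, A (t i).

(* Relations hold, and functions are defined, only on tuples of the universe,
   so that Leibniz equality of models is equality of set-theoretic
   structures. *)
Record model (tau : vocabulary) := Model {
  univ : set V;
  rsem : forall R : predsym tau, set (parity R -> V);
  fsem : forall F : funsym tau, (farity F -> V) -> option V;
  rel_univ : forall R t, rsem (R := R) t -> tuple_in univ t;
  fn_univ : forall F t, tuple_in univ t ->
    exists2 y, univ y & fsem (F := F) t = Some y;
  fn_out : forall F t, ~ tuple_in univ t -> fsem (F := F) t = None
}.

Variable tau : vocabulary.
Implicit Types (M N : model tau) (f : V -> V).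

Definition submodel M N : Prop :=
  [/\ univ M `<=` univ N,
      forall (R : predsym tau) (t : parity R -> V), tuple_in (univ M) t ->
        (rsem M t <-> rsem N t)
    & forall (F : funsym tau) (t : farity F -> V), tuple_in (univ M) t ->
        fsem M t = fsem N t].

(* Maps between models are total functions on V; only their values on the
   universe of the source matter. *)
Definition model_iso f M N : Prop :=
  [/\ set_bij (univ M) (univ N) f,
      forall (R : predsym tau) (t : parity R -> V), tuple_in (univ M) t ->
        (rsem M t <-> rsem N (f \o t))
    & forall (F : funsym tau) (t : farity F -> V), tuple_in (univ M) t ->
        fsem N (f \o t) = omap f (fsem M t)].

Definition isomorphic M N : Prop := exists f, model_iso f M N.

End Models.

Arguments rsem {tau} m {R} t.
Arguments fsem {tau} m {F} t.

(* Limit ordinals, as small well-ordered types. *)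
Record limit_order (I : Small) (lt : I -> I -> Prop) : Prop := LimitOrder {
  lo_wf : well_founded lt;
  lo_trans : forall i j k, lt i j -> lt j k -> lt i k;
  lo_total : forall i j, [\/ lt i j, i = j | lt j i];
  lo_nonempty : exists i : I, True;
  lo_nolast : forall i, exists j, lt i j
}.

Definition limit_at (I : Small) (lt : I -> I -> Prop) (i : I) : Prop :=
  (exists j, lt j i) /\ (forall j, lt j i -> exists2 k, lt j k & lt k i).

Definition least (I : Small) (lt : I -> I -> Prop) (i : I) : Prop :=
  forall j, ~ lt j i.

Record aec (tau : vocabulary) := AEC {
  inK : set (model tau);
  lek : model tau -> model tau -> Prop
}.

Section Aec.

Variables (tau : vocabulary) (k : aec tau).
Implicit Types (M N : model tau) (f : V -> V).

Definition K_card (chi : Small) M : Prop := inK k M /\ univ M #= [set: chi].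

Definition ltk M N : Prop := lek k M N /\ M <> N.

Definition increasing (I : Small) (lt : I -> I -> Prop) (Mi : I -> model tau) :=
  forall i j, lt i j -> lek k (Mi i) (Mi j).

(* The union of the M_i, i in J, in the sense of k. *)
Definition is_union (I : Small) (J : set I) (Mi : I -> model tau) M : Prop :=
  [/\ inK k M, univ M = \bigcup_(i in J) univ (Mi i)
    & forall i, J i -> lek k (Mi i) M].

(* <M_i : i <= delta> is increasing continuous, where delta is the order type
   of (I, lt) and M = M_delta. *)
Definition inc_cont (I : Small) (lt : I -> I -> Prop) (Mi : I -> model tau) M :=
  [/\ increasing lt Mi,
      forall i, limit_at lt i -> is_union [set j | lt j i] Mi (Mi i)
    & is_union setT Mi M].

Definition lek_embedding f M N : Prop :=
  exists2 M', model_iso f M M' & lek k M' N.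

Record ess_aec (lam : Small) (mu : option Small) : Prop := EssAec {
  aec_par : forall R : predsym tau, [set: parity R] #<= [set: lam];
  aec_far : forall F : funsym tau, [set: farity F] #<= [set: lam];
  aec_leK : forall M N, lek k M N -> inK k M /\ inK k N;
  aec_sub : forall M N, lek k M N -> submodel M N;
  aec_isoK : forall f M N, model_iso f M N -> inK k M -> inK k N;
  aec_isole : forall f M1 M2 N1 N2,
    lek k M1 M2 -> model_iso f M2 N2 -> model_iso f M1 N1 -> submodel N1 N2 ->
    lek k N1 N2;
  aec_card : forall M, inK k M ->
    [set: lam] #<= univ M /\ card_below mu (univ M);
  aec_refl : forall M, inK k M -> lek k M M;
  aec_trans : forall M1 M2 M3, lek k M1 M2 -> lek k M2 M3 -> lek k M1 M3;
  aec_anti : forall M N, lek k M N -> lek k N M -> M = N;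
  aec_union : forall (I : Small) (lt : I -> I -> Prop) (Mi : I -> model tau),
    limit_order lt -> increasing lt Mi ->
    card_below mu (\bigcup_i univ (Mi i)) ->
    exists! M, is_union setT Mi M;
  aec_union_le : forall (I : Small) (lt : I -> I -> Prop)
      (Mi : I -> model tau) M N,
    limit_order lt -> increasing lt Mi -> is_union setT Mi M ->
    (forall i, lek k (Mi i) N) -> lek k M N;
  aec_coherence : forall M1 M2 N,
    submodel M1 M2 -> lek k M1 N -> lek k M2 N -> lek k M1 M2;
  aec_LS : forall (A : set V) N, inK k N -> A `<=` univ N ->
    exists M, [/\ A `<=` univ M, lek k M N
                & univ M #<= [set: (lam + set_type A)%type]]
}.

(* An orbital type is an equivalence class of triples (M, N, a). *)
Definition type_triple : Type := (model tau * model tau * V)%type.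
Definition otype : Type := set type_triple.

Definition at_rel (t1 t2 : type_triple) : Prop :=
  let: (M1, N1, a1) := t1 in
  let: (M2, N2, a2) := t2 in
  [/\ M1 = M2,
      lek k M1 N1 /\ univ N1 a1,
      lek k M2 N2 /\ univ N2 a2
    & exists N f1 f2,
        [/\ lek_embedding f1 N1 N, lek_embedding f2 N2 N,
            forall x, univ M1 x -> f1 x = x,
            forall x, univ M1 x -> f2 x = x
          & f1 a1 = f2 a2]].

Definition ortp (a : V) M N : otype :=
  [set t | clos_trans type_triple at_rel (M, N, a) t].

Definition orbital_types M : set otype :=
  [set p | exists N a, [/\ lek k M N, univ N a & p = ortp a M N]].

(* For p a type over a model extending M, all ortp a M N with (M', N, a) in p
   are equal, and the union below is their common value. *)
Definition restr (p : otype) M : otype :=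
  [set t | exists M' N a, p (M', N, a) /\ ortp a M N t].

Definition iso_classes (kappa : Small) : set (set (model tau)) :=
  [set C | exists2 M, K_card kappa M & C = [set N | isomorphic M N]].

Record superlimit (chi : Small) M : Prop := Superlimit {
  sl_card : K_card chi M;
  sl_univ : forall M1, K_card chi M1 ->
    exists M2, [/\ isomorphic M2 M, ltk M1 M2 & K_card chi M2];
  sl_union : forall (I : Small) (lt : I -> I -> Prop) (Mi : I -> model tau) N,
    limit_order lt -> [set: I] #<= [set: chi] ->
    increasing lt Mi -> (forall i, isomorphic (Mi i) M) ->
    is_union setT Mi N -> isomorphic N M
}.

Definition amalgamation : Prop := forall M0 M1 M2, lek k M0 M1 -> lek k M0 M2 ->
  exists N f1 f2, [/\ lek_embedding f1 M1 N, lek_embedding f2 M2 N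
                    & forall x, univ M0 x -> f1 x = f2 x].

Definition joint_embedding : Prop := forall M1 M2, inK k M1 -> inK k M2 ->
  exists N f1 f2, lek_embedding f1 M1 N /\ lek_embedding f2 M2 N.

Definition no_maximal : Prop := forall M, inK k M -> exists N, ltk M N.

End Aec.

Record frame (tau : vocabulary) := Frame {
  faec :> aec tau;
  bs : model tau -> set (otype tau);
  nf : model tau -> model tau -> V -> model tau -> Prop
}.

Section Frame.

Variables (tau : vocabulary) (s : frame tau).
Implicit Types (M N : model tau) (p q : otype tau) (f : V -> V).

(* p, a type over M, does not fork over M0.  In a good frame this does not
   depend on the choice of (N, a) representing p. *)
Definition dnf p M M0 : Prop :=
  exists N a, [/\ lek s M N, univ N a, p = ortp s a M N & nf s M0 M a N].

Record good_frame (lam : Small) (mu : option Small) : Prop := GoodFrame {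
  gf_aec : ess_aec s lam mu;

  gf_superlimit : forall chi : Small,
    [set: lam] #<= [set: chi] -> card_below mu [set: chi] ->
    exists M, superlimit s chi M;
  gf_few : iso_classes s lam #<= [set: set lam];

  gf_ap : amalgamation s;
  gf_jep : joint_embedding s;
  gf_nomax : no_maximal s;

  gf_bs_types : forall M, inK s M -> bs s M `<=` orbital_types s M;
  gf_bs_iso : forall f M N M' N' a,
    lek s M N -> lek s M' N' -> univ N a ->
    model_iso f N N' -> model_iso f M M' ->
    bs s M (ortp s a M N) -> bs s M' (ortp s (f a) M' N');
  gf_bs_nonalg : forall M N a,
    lek s M N -> univ N a -> bs s M (ortp s a M N) -> ~ univ M a;
  gf_bs_density : forall M N, lek s M N -> M <> N ->
    exists a, [/\ univ N a, ~ univ M a & bs s M (ortp s a M N)];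
  gf_bs_stable : forall M, inK s M -> bs s M #<= univ M;

  gf_nf_iso : forall f M0 M1 a M3 M0' M1' M3',
    lek s M0' M1' -> lek s M1' M3' ->
    model_iso f M3 M3' -> model_iso f M0 M0' -> model_iso f M1 M1' ->
    nf s M0 M1 a M3 -> nf s M0' M1' (f a) M3';
  gf_nf_dom : forall M0 M1 a M3, nf s M0 M1 a M3 ->
    [/\ lek s M0 M1 /\ lek s M1 M3, univ M3 a /\ ~ univ M1 a,
        bs s M0 (ortp s a M0 M3) & bs s M1 (ortp s a M1 M3)];
  gf_nf_bs : forall M0 a M3, lek s M0 M3 -> univ M3 a ->
    (nf s M0 M0 a M3 <-> bs s M0 (ortp s a M0 M3));

  gf_monotonicity : forall M0 M0' M1' M1 M3 M3' M3'' a,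
    lek s M0 M0' -> lek s M0' M1' -> lek s M1' M1 ->
    lek s M1 M3 -> lek s M3 M3' ->
    univ M1 `|` [set a] `<=` univ M3'' -> lek s M3'' M3' ->
    (nf s M0 M1 a M3 -> nf s M0' M1' a M3') /\
    (nf s M0' M1' a M3' <-> nf s M0' M1' a M3'');

  gf_local_character : forall (I : Small) (lt : I -> I -> Prop)
      (Mi : I -> model tau) M p,
    limit_order lt -> inc_cont s lt Mi M -> bs s M p ->
    exists i, dnf p M (Mi i);

  gf_transitivity : forall M0 M0' M0'' M3 a,
    lek s M0 M0' -> lek s M0' M0'' -> lek s M0'' M3 -> univ M3 a ->
    nf s M0' M0'' a M3 -> nf s M0 M0' a M3 -> nf s M0 M0'' a M3;

  gf_uniqueness : forall M0 M1 p q, lek s M0 M1 ->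
    bs s M1 p -> bs s M1 q -> dnf p M1 M0 -> dnf q M1 M0 ->
    restr s p M0 = restr s q M0 -> p = q;

  gf_symmetry : forall M0 M3 a1 a2,
    lek s M0 M3 -> univ M3 a1 -> univ M3 a2 ->
    bs s M0 (ortp s a1 M0 M3) -> bs s M0 (ortp s a2 M0 M3) ->
    ((exists M1 M3', [/\ lek s M0 M1 /\ lek s M1 M3', univ M1 a1,
                         lek s M3 M3' & nf s M0 M1 a2 M3']) <->
     (exists M2 M3', [/\ lek s M0 M2 /\ lek s M2 M3', univ M2 a2,
                         lek s M3 M3' & nf s M0 M2 a1 M3']));

  gf_existence : forall M N p, lek s M N -> bs s M p ->
    exists q, [/\ bs s N q, restr s q M = p & dnf q N M];

  gf_continuity : forall (I : Small) (lt : I -> I -> Prop)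
      (Mi : I -> model tau) M i0 p,
    limit_order lt -> inc_cont s lt Mi M -> least lt i0 ->
    orbital_types s M p ->
    (forall i, dnf (restr s p (Mi i)) (Mi i) (Mi i0)) ->
    bs s M p /\ dnf p M (Mi i0)
}.

Definition prime_triple M N a : Prop :=
  [/\ lek s M N, univ N a, bs s M (ortp s a M N)
    & forall N' a', lek s M N' -> univ N' a' ->
        ortp s a' M N' = ortp s a M N ->
        exists f, [/\ lek_embedding s f N N', forall x, univ M x -> f x = x
                    & f a = a']].

Definition has_primes : Prop := forall M p, inK s M -> bs s M p ->
  exists N a, prime_triple M N a /\ ortp s a M N = p.

Definition weakly_orthogonal M0 p1 p2 : Prop := forall M1 M2 M3 a1 a2,
  lek s M0 M1 -> lek s M1 M3 -> lek s M0 M2 -> lek s M2 M3 ->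
  prime_triple M0 M1 a1 -> prime_triple M0 M2 a2 ->
  ortp s a1 M0 M1 = p1 -> ortp s a2 M0 M2 = p2 ->
  nf s M0 M1 a2 M3.

Definition nf_extension M p N q : Prop :=
  [/\ bs s N q, restr s q M = p & dnf q N M].

Definition orthogonal_types M1 p1 M2 p2 : Prop := forall N q1 q2,
  lek s M1 N -> lek s M2 N ->
  nf_extension M1 p1 N q1 -> nf_extension M2 p2 N q2 ->
  weakly_orthogonal N q1 q2.

Definition regular_type M p : Prop :=
  bs s M p /\
  forall N q, lek s M N -> bs s N q -> restr s q M = p -> ~ dnf q N M ->
    orthogonal_types M p N q.

Definition has_regulars : Prop := forall M N, lek s M N -> M <> N ->
  exists c, [/\ univ N c, ~ univ M c & regular_type M (ortp s c M N)].

End Frame.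

Section SmoothEquivalence.

Variables (lam : Small) (tau : vocabulary) (k : aec tau).
Implicit Types (M N : model tau) (a b : lam -> V).

(* M restricted to Rang(a) is the submodel of M whose universe is range a. *)
Definition seq_of M : set (lam -> V) :=
  [set a | exists2 M', univ M' = range a & lek k M' M].

Definition seq_relation : Type := model tau -> (lam -> V) -> (lam -> V) -> Prop.

Variable E : seq_relation.

(* An equivalence relation on a subset is a symmetric and transitive relation;
   the subset is where it is reflexive. *)
Definition dom_E M : set (lam -> V) := [set a | E M a a].

Definition E_classes M : set (set (lam -> V)) :=
  [set C | exists2 a, dom_E M a & C = [set b | E M a b]].

Record smooth : Prop := Smooth {
  sm_sym : forall M a b, inK k M -> E M a b -> E M b a;
  sm_trans : forall M a b c, inK k M -> E M a b -> E M b c -> E M a c;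
  sm_dom : forall M, inK k M -> dom_E M `<=` seq_of M;
  sm_restr : forall M1 M2 a b, lek k M1 M2 ->
    (E M1 a b <-> [/\ E M2 a b, seq_of M1 a & seq_of M1 b]);
  sm_iso : forall f M1 M2 a b, inK k M1 -> inK k M2 -> model_iso f M1 M2 ->
    tuple_in (univ M1) a -> tuple_in (univ M1) b ->
    (E M1 a b <-> E M2 (f \o a) (f \o b));
  sm_cont : forall (I : Small) (lt : I -> I -> Prop) (Mi : I -> model tau) M a,
    limit_order lt -> inc_cont k lt Mi M -> dom_E M a ->
    exists i b, dom_E (Mi i) b /\ E M a b
}.

Definition small_E : Prop := forall M, inK k M -> E_classes M #<= univ M.

End SmoothEquivalence.

Section Extension.

Variables (lam : Small) (tau : vocabulary).

Inductive ext_predsym : Type := OldP (R : predsym tau) | Pstar.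
Inductive ext_funsym : Type := OldF (F : funsym tau) | Fstar | Cstar.

Definition ext_par (R : ext_predsym) : Small :=
  match R with OldP R => parity R | Pstar => unit end.
Definition ext_far (F : ext_funsym) : Small :=
  match F with OldF F => farity F | Fstar => lam | Cstar => void end.

Definition ext_voc : vocabulary :=
  @Vocabulary ext_predsym ext_funsym ext_par ext_far.

Definition rsem_old (Ms : model ext_voc) (R : predsym tau)
    (t : parity R -> V) : Prop :=
  @rsem ext_voc Ms (OldP R) t.
Definition fsem_old (Ms : model ext_voc) (F : funsym tau)
    (t : farity F -> V) : option V :=
  @fsem ext_voc Ms (OldF F) t.
Definition rsem_P (Ms : model ext_voc) (x : V) : Prop :=
  @rsem ext_voc Ms Pstar (fun _ : unit => x).
Definition fsem_F (Ms : model ext_voc) (a : lam -> V) : option V :=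
  @fsem ext_voc Ms Fstar a.
Definition fsem_c (Ms : model ext_voc) : option V :=
  @fsem ext_voc Ms Cstar (of_void V).

Variables (k : aec tau) (E : seq_relation lam tau).

Record witness (Ms : model ext_voc) (M : model tau) : Prop := Witness {
  w_K : inK k M;
  w_P : univ M = rsem_P Ms;
  w_rel : forall (R : predsym tau) (t : parity R -> V),
    rsem_old Ms t <-> rsem M t;
  w_fn : forall (F : funsym tau) (t : farity F -> V),
    tuple_in (univ M) t -> fsem_old Ms t = fsem M t;
  w_fn_out : forall (F : funsym tau) (t : farity F -> V),
    tuple_in (univ Ms) t -> ~ tuple_in (univ M) t -> fsem_old Ms t = fsem_c Ms;
  w_c : forall c, fsem_c Ms = Some c -> ~ univ M c;
  w_F_onto : fsem_F Ms @` dom_E E M =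
    Some @` [set y | [/\ univ Ms y, ~ univ M y & fsem_c Ms <> Some y]];
  w_F_eq : forall a b, dom_E E M a -> dom_E E M b ->
    (fsem_F Ms a = fsem_F Ms b <-> E M a b);
  w_F_out : forall a, tuple_in (univ Ms) a -> ~ dom_E E M a ->
    fsem_F Ms a = fsem_c Ms
}.

Definition ext_aec : aec ext_voc := {|
  inK := [set Ms | exists M, witness Ms M];
  lek := fun Ms Ns => submodel Ms Ns /\
    exists M N, [/\ witness Ms M, witness Ns N & lek k M N]
|}.

End Extension.

Section FrameExtension.

Variables (lam : Small) (tau : vocabulary) (s : frame tau).
Variable E : seq_relation lam tau.

Definition ext_bs (Ms : model (ext_voc lam tau)) :
    set (otype (ext_voc lam tau)) :=
  [set p | exists Ns M N a,
     [/\ lek (ext_aec s E) Ms Ns,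
         [/\ witness s E Ms M, witness s E Ns N & lek s M N],
         univ N a /\ ~ univ M a,
         bs s M (ortp s a M N)
       & p = ortp (ext_aec s E) a Ms Ns]].

Definition ext_nf (Ms0 Ms1 : model (ext_voc lam tau)) (a : V)
    (Ms3 : model (ext_voc lam tau)) : Prop :=
  [/\ lek (ext_aec s E) Ms0 Ms1, lek (ext_aec s E) Ms1 Ms3
    & exists M0 M1 M3,
        [/\ witness s E Ms0 M0, witness s E Ms1 M1, witness s E Ms3 M3
          & nf s M0 M1 a M3]].

Definition ext_frame : frame (ext_voc lam tau) :=
  {| faec := ext_aec s E; bs := ext_bs; nf := ext_nf |}.

End FrameExtension.

(* Main.v *)
From Stdlib Require Import Relation_Operators Inverse_Image.
Require Import Defs.
From mathcomp Require Import all_boot boolp classical_sets functions cardinality.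
From mathcomp Require Import wochoice.

(** Adding the classes of E as new elements changes nothing essential: an
    extended model Ms is determined by its witness M together with a set of
    labels for the new elements (the constant, and one value of F_* for each
    class of E_M), and the labels are immaterial.  Everything below is a
    transfer along Ms |-> M.

    In one direction, M is definable in Ms, so embeddings and isomorphisms of
    extended models restrict to the witnesses (iso_ext, iso_w, emb_ext).  In the
    other direction, they extend from the witnesses (ext_iso, ext_emb), because
    E is invariant, and extended models over a given M exist with prescribed
    labels (ext_exists), because the universe V is a proper class and thus
    leaves room outside every small set (fresh_copy).  Restricting Ns to a
    smaller witness is always possible (ext_restrict).  Enlarging Ms to have a
    given N above M as its witness is possible only after moving N away from the
    labels of Ms (ext_extend); this is harmless, since all notions are invariant
    under isomorphisms over M.

    The central step is ext_ortp: for elements of the witnesses, equality of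
    types over Ms is equality of types over M.  It uses that under amalgamation
    two triples have the same type exactly when they are identified in one
    common extension (ortp_eqP).  It follows that basic types, non-forking, primes and
    non-forking extensions over Ms and over M correspond, and each property of
    the frame is read off from the same property of s.

    Two points need more than transfer.  For unions of chains, every class over
    the union must be represented in the chain; smoothness gives this for
    continuous chains, and an arbitrary increasing chain is first refined to a
    continuous one (continuous_refinement).  Cardinalities agree because E is
    small and the product of an infinite cardinal with itself is that cardinal
    (card_square); this also gives the Loewenheim-Skolem property. *)

Set Implicit Arguments.
Unset Strict Implicit.
Unset Printing Implicit Defensive.

Local Open Scope classical_set_scope.
Local Open Scope card_scope.

(** * Cardinals *)

(** Relations in place of functions, because the target type may be empty. *)
Lemma card_leRP T U (A : set T) (B : set U) :
  A #<= B -> exists R : T -> U -> Prop,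
    [/\ forall x y, R x y -> A x /\ B y,
        forall x, A x -> exists y, R x y,
        forall x y y', R x y -> R x y' -> y = y'
      & forall x x' y, R x y -> R x' y -> x = x'].
Proof.
move=> /card_leP[f].
exists (fun x y => exists (Ax : A x), y = set_val (f (SigSub (mem_set Ax)))).
split=> [x y [Ax ->]|x Ax|x y y' [h ->] [h' ->]|x x' y [h ->] [h' /val_inj e]].
- by split=> //; exact: set_valP.
- by exists (set_val (f (SigSub (mem_set Ax)))), Ax.
- by rewrite (Prop_irrelevance h h').
have /(congr1 val) // : SigSub (mem_set h) = SigSub (mem_set h').
by apply: (@inj _ _ _ f) e; rewrite inE.
Qed.

Lemma card_leR T U (A : set T) (B : set U) (R : T -> U -> Prop) :
  (forall x, A x -> exists2 y, B y & R x y) ->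
  (forall x x' y, A x -> A x' -> R x y -> R x' y -> x = x') -> A #<= B.
Proof.
move=> Rf Rinj.
have /choice[g gP] : forall x : A, exists y : B, R (set_val x) (set_val y).
  move=> x; have [y By Rxy] := Rf _ (set_valP x).
  by exists (SigSub (mem_set By)).
apply/card_leP/injfunPex; exists g => // x x' _ _ e; apply: val_inj.
apply: (Rinj _ _ (set_val (g x))) (gP x) _; [exact: set_valP..|].
by rewrite e; exact: gP.
Qed.

Lemma card_le_fun T U (A : set T) (B : set U) (f : T -> U) :
  (forall x, A x -> B (f x)) ->
  (forall x y, A x -> A y -> f x = f y -> x = y) -> A #<= B.
Proof.
move=> fAB finj; apply: (@card_leR _ _ _ _ (fun x y => f x = y)).
  by move=> x Ax; exists (f x) => //; exact: fAB.
by move=> x x' y Ax Ax' <- e; exact: (finj _ _ Ax Ax').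
Qed.

(** A maximal partial bijection exhausts one of the two sides. *)
Lemma card_le_total T U (A : set T) (B : set U) : A #<= B \/ B #<= A.
Proof.
pose P (G : set (T * U)) :=
  (forall p, G p -> A p.1 /\ B p.2) /\
  (forall p q, G p -> G q -> p.1 = q.1 \/ p.2 = q.2 -> p = q).
have [|G [[Gs Gi] Gmax]] := @Zorn_bigcup _ P.
  move=> F FP Ft; split=> [p [X FX Xp]|p q [X FX Xp] [Y FY Yq] e].
    exact: (FP _ FX).1.
  have [XY|YX] := Ft _ _ FX FY.
    by apply: (FP _ FY).2 => //; exact: XY.
  by apply: (FP _ FX).2 => //; exact: YX.
have [GA|/existsNP[x /not_implyP[Ax nx]]] :=
    pselect (forall x, A x -> exists y, G (x, y)).
  left; apply: (@card_leR _ _ _ _ (fun x y => G (x, y))).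
    by move=> x Ax; have [y Gxy] := GA x Ax; exists y => //; exact: (Gs _ Gxy).2.
  by move=> x x' y _ _ h h'; have [] := Gi _ _ h h' (or_intror erefl).
right; apply: (@card_leR _ _ _ _ (fun y x => G (x, y))); last first.
  by move=> y y' x' _ _ h h'; have [] := Gi _ _ h h' (or_introl erefl).
move=> y By; apply: contrapT => ny; apply: (Gmax (G `|` [set (x, y)])).
  split; first exact: subsetUl.
  by move=> /(_ (x, y) (or_intror erefl)) Gxy; apply: nx; exists y.
have key (p : T * U) : G p -> p.1 = x \/ p.2 = y -> False.
  case: p => u v Gp [/= e|/= e]; subst; first by apply: nx; exists v.
  by apply: ny; exists u => //; exact: (Gs _ Gp).1.
split=> [p [/Gs//|->//]|p q].
move=> [Gp|->] [Gq|->] //=; first exact: Gi.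
  by move=> /(key _ Gp).
by move=> [e|e]; case: (key _ Gq); [left|right].
Qed.

Lemma card_leX T U T' U' (A : set T) (B : set U) (A' : set T') (B' : set U') :
  A #<= A' -> B #<= B' -> A `*` B #<= A' `*` B'.
Proof.
move=> /card_leRP[R [R1 R2 R3 R4]] /card_leRP[S [S1 S2 S3 S4]].
apply: (@card_leR _ _ _ _ (fun p q => R p.1 q.1 /\ S p.2 q.2)).
  move=> [x y] [/= Ax By]; have [x' xx'] := R2 _ Ax; have [y' yy'] := S2 _ By.
  by exists (x', y') => //; split; [case: (R1 _ _ xx')|case: (S1 _ _ yy')].
move=> [x y] [x1 y1] [x' y'] _ _ /= [h1 h2] [h3 h4].
by rewrite (R4 _ _ _ h1 h3) (S4 _ _ _ h2 h4).
Qed.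

Lemma infinite_seq T (A : set T) : infinite_set A ->
  exists f : nat -> T, injective f /\ forall n, A (f n).
Proof.
move=> /infiniteP/card_leRP[R [R1 R2 R3 R4]].
have /choice[f fP] : forall n, exists x, R n x by move=> n; exact: R2.
exists f; split=> [m n e|n]; last by case: (R1 _ _ (fP n)).
by apply: (R4 _ _ (f m)); [|rewrite e]; exact: fP.
Qed.

(** A union of two sets embeds into a product with a two-element set. *)
Lemma card_leU_sq T U (A B : set T) (C : set U) : infinite_set C ->
  C `*` C #<= C -> A #<= C -> B #<= C -> A `|` B #<= C.
Proof.
move=> /infinite_seq[f [finj fC]] CC /card_leRP[R [R1 R2 _ R4]].
move=> /card_leRP[S [S1 S2 _ S4]]; apply: card_le_trans CC.
have f01 : f 0 <> f 1 by move=> /finj.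
apply: (@card_leR _ _ _ _ (fun x p =>
    (A x /\ R x p.1 /\ p.2 = f 0) \/ (~ A x /\ S x p.1 /\ p.2 = f 1))).
  move=> x ABx; have [Ax|nAx] := pselect (A x).
    have [y xy] := R2 _ Ax; exists (y, f 0); last by left.
    by split=> //=; case: (R1 _ _ xy).
  have [//|Bx] := ABx; have [y xy] := S2 _ Bx.
  by exists (y, f 1); [split=> //=; case: (S1 _ _ xy)|right].
move=> x x' [y z] _ _ /= [[_ [h e]]|[_ [h e]]] [[_ [h' e']]|[_ [h' e']]].
- exact: R4 h h'.
- by case: f01; rewrite -e.
- by case: f01; rewrite -e.
- exact: S4 h h'.
Qed.

(** The set X underlying the graph of an operation X * X -> X. *)
Definition diag T (G : set (T * T * T)) : set T := [set x | exists z, G (x, x, z)].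

(** G is the graph of an injection X * X -> X with X infinite and inside A. *)
Definition square_graph T (A : set T) (G : set (T * T * T)) : Prop :=
  [/\ infinite_set (diag G), diag G `<=` A,
      forall x y z, G (x, y, z) -> [/\ diag G x, diag G y & diag G z],
      forall x y, diag G x -> diag G y -> exists z, G (x, y, z)
    & forall x y z x' y' z', G (x, y, z) -> G (x', y', z') ->
        ((x, y) = (x', y') <-> z = z')].

Lemma square_graph_card T (A : set T) G : square_graph A G ->
  diag G `*` diag G #<= diag G.
Proof.
move=> [_ _ h3 h4 h5]; apply: (@card_leR _ _ _ _ (fun p z => G (p.1, p.2, z))).
  move=> [x y] [/= Dx Dy]; have [z Gz] := h4 _ _ Dx Dy.
  by exists z => //; case: (h3 _ _ _ Gz).
by move=> [x y] [x' y'] z _ _ /= h h'; apply/(h5 _ _ _ _ _ _ h h').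
Qed.

(** Hessenberg: among the infinite subsets X of A with an injection of X * X
    into X take one with a maximal graph.  If its complement in A had a copy Y
    of X, then the injection would extend to X and Y together, the new pairs
    being sent into Y; so the complement embeds in X, and A with it. *)
Lemma card_square T (A : set T) : infinite_set A -> A `*` A #<= A.
Proof.
move=> Ainf.
(* The empty graph is there to bound the empty chain. *)
pose P (G : set (T * T * T)) := G = set0 \/ square_graph A G.
have [|G [PG Gmax]] := @Zorn_bigcup _ P.
  move=> F FP Ft; have [F0|/existsNP[G0 /not_implyP[FG0 G0n]]] :=
      pselect (forall G, F G -> G = set0).
    left; apply/seteqP; split=> // p [G FG Gp].
    by rewrite (F0 _ FG) in Gp.
  have FQ G p : F G -> G p -> square_graph A G.
    by move=> FG Gp; case: (FP _ FG) => // G0'; rewrite G0' in Gp.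
  have QG0 : square_graph A G0 by case: (FP _ FG0).
  pose H := \bigcup_(X in F) X.
  have sub G : F G -> diag G `<=` diag H.
    by move=> FG x [z Gz]; exists z, G.
  have two G1 G2 : F G1 -> F G2 -> exists G3, [/\ F G3, G1 `<=` G3 & G2 `<=` G3].
    move=> FG1 FG2; have [h|h] := Ft _ _ FG1 FG2; first by exists G2; split.
    by exists G1; split.
  right; rewrite -/H; split.
  - by case: QG0 => h _ _ _ _; apply: sub_infinite_set h; exact: sub.
  - by move=> x [z [G1 FG1 Gz]]; case: (FQ _ _ FG1 Gz) => _ + _ _ _; apply; exists z.
  - move=> x y z [G1 FG1 Gz]; case: (FQ _ _ FG1 Gz) => _ _ /(_ _ _ _ Gz)[? ? ?] _ _.
    by split; apply: (sub _ FG1).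
  - move=> x y [z [G1 FG1 Gx]] [z' [G2 FG2 Gy]].
    have [G3 [FG3 s1 s2]] := two _ _ FG1 FG2.
    have [_ _ _ + _] := FQ _ _ FG3 (s1 _ Gx).
    move=> /(_ x y) []; [by exists z; apply: s1|by exists z'; apply: s2|].
    by move=> w Gw; exists w, G3.
  - move=> x y z x' y' z' [G1 FG1 Gx] [G2 FG2 Gy].
    have [G3 [FG3 s1 s2]] := two _ _ FG1 FG2.
    have [_ _ _ _] := FQ _ _ FG3 (s1 _ Gx).
    by apply; [exact: s1|exact: s2].
have QG : square_graph A G.
  case: PG => // G0; have [f [finj fA]] := infinite_seq Ainf.
  pose G1 : set (T * T * T) :=
    [set p | exists m n, p = (f m, f n, f (pickle (m, n)))].
  have D1 : diag G1 = range f.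
    apply/seteqP; split=> [x [z [m [n [-> _ _]]]]|_ [n _ <-]]; first by exists m.
    by exists (f (pickle (n, n))), n, n.
  case: (Gmax G1).
    rewrite G0; split=> // /(_ (f 0, f 0, f (pickle (0, 0)))); apply.
    by exists 0, 0.
  right; split; rewrite ?D1.
  - apply/infiniteP; apply: (@card_le_fun _ _ _ _ f) => [n _|m n _ _ /finj//].
    by exists n.
  - by move=> _ [n _ <-].
  - by move=> x y z [m [n [-> -> ->]]]; split; [exists m|exists n|exists (pickle (m, n))].
  - by move=> _ _ [m _ <-] [n _ <-]; exists (f (pickle (m, n))), m, n.
  - move=> x y z x' y' z' [m [n [-> -> ->]]] [m' [n' [-> -> ->]]].
    split=> [[/finj-> /finj->]//|/finj/(pcan_inj pickleK)[-> ->//]].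
have [Xinf XA h3 h4 h5] := QG; have XX := square_graph_card QG.
set X := diag G in Xinf XA h3 h4 h5 XX.
have leX : A #<= X -> A `*` A #<= A.
  move=> AX; apply: card_le_trans (subset_card_le XA).
  by apply: card_le_trans XX; exact: card_leX.
have [XY|YX] := card_le_total X (A `\` X); last first.
  apply: leX; apply: (@card_le_trans _ _ _ (X `|` (A `\` X))); last first.
    exact: card_leU_sq.
  by apply: subset_card_le => x Ax; have [|] := pselect (X x); [left|right].
have [R0 [R1 R2 R3 R4]] := card_leRP XY.
pose Y := [set y | exists x, R0 x y].
have YA : Y `<=` A `\` X by move=> y [x /R1[]].
have leXY : X #<= Y.
  apply: (@card_leR _ _ _ _ R0) => [x Xx|x x' y _ _]; last exact: R4.
  by have [y xy] := R2 _ Xx; exists y => //; exists x.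
have leYX : Y #<= X.
  apply: (@card_leR _ _ _ _ (fun y x => R0 x y)) => [y [x xy]|y y' x _ _].
    by exists x => //; case: (R1 _ _ xy).
  exact: R3.
pose S := ((X `|` Y) `*` (X `|` Y)) `\` (X `*` X).
have SY : S #<= Y.
  apply: card_le_trans leXY; apply: (card_le_trans _ XX).
  apply: (@card_le_trans _ _ _ ((X `|` Y) `*` (X `|` Y))).
    by apply: subset_card_le => p [].
  by apply: card_leX; apply: (card_leU_sq Xinf XX) leYX; exact: (card_lexx X).
have [S0 [S1 S2 S3 S4]] := card_leRP SY.
pose G' := G `|` [set p | S0 p.1 p.2].
have DG' : diag G' = X `|` Y.
  apply/seteqP; split=> [x [z [Gz|/= /S1[[[/= ? ?] _] _]//]]|x].
    by left; exists z.
  move=> [[z Gz]|Yx]; first by exists z; left.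
  have [|z xz] := S2 (x, x); last by exists z; right.
  by split=> [|[/= Xx _]]; [split; right|case: (YA _ Yx)].
case: (Gmax G').
  split=> [|GG]; first exact: subsetUl.
  have [n Xn] := infinite_setN0 Xinf; have [y ny] := R2 _ Xn.
  have Yy : Y y by exists n.
  have [z [Gz|/= yz]] : diag G' y by rewrite DG'; right.
    by case: (YA _ Yy) => _; apply; exists z.
  by case: (YA _ Yy) => _; apply; exists z; apply: GG; right.
have Sz x y z : S0 (x, y) z -> Y z /\ ~ (X x /\ X y).
  by move=> /S1[[_ nX] Yz]; split.
right; split; rewrite ?DG'.
- by apply: sub_infinite_set Xinf; exact: subsetUl.
- by move=> x [/XA//|/YA[]].
- move=> x y z [/h3[? ? ?]|/= /S1[[[/= ? ?] _] ?]]; first by split; left.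
  by split=> //; right.
- move=> x y XYx XYy; have [[Xx Xy]|nXX] := pselect (X x /\ X y).
    by have [z Gz] := h4 _ _ Xx Xy; exists z; left.
  by have [|z xyz] := S2 (x, y); [split|exists z; right].
- move=> x y z x' y' z' [h|/= h] [h'|/= h']; first exact: h5 h h'.
  + have [Xx Xy Xz] := h3 _ _ _ h; have [Yz' nX] := Sz _ _ _ h'.
    by split=> [[? ?]|e]; subst; [case: nX|case: (YA _ Yz')].
  + have [Xx Xy Xz] := h3 _ _ _ h'; have [Yz' nX] := Sz _ _ _ h.
    by split=> [[? ?]|e]; subst; [case: nX|case: (YA _ Yz')].
  + split=> [e|e]; subst; last exact: S4 h h'.
    by case: e h' => <- <-; exact: S3 h.
Qed.

Lemma card_leU T U (A B : set T) (C : set U) : infinite_set C ->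
  A #<= C -> B #<= C -> A `|` B #<= C.
Proof. by move=> Ci; apply: card_leU_sq => //; exact: card_square. Qed.

(** * Room outside small sets *)

Definition small_set T (A : set T) : Prop := exists k : Small, A #<= [set: k].

Lemma small_set_le T U (A : set T) (B : set U) :
  A #<= B -> small_set B -> small_set A.
Proof. by move=> AB [k Bk]; exists k; exact: card_le_trans AB Bk. Qed.

Lemma small_setU T (A B : set T) :
  small_set A -> small_set B -> small_set (A `|` B).
Proof.
move=> [k /card_leRP[R [R1 R2 R3 R4]]] [l /card_leRP[S [S1 S2 S3 S4]]].
exists (k + l)%type.
apply: (@card_leR _ _ _ _ (fun x y => match y with
  | inl u => R x u | inr v => S x v end)).
  by move=> x [/R2|/S2][y xy]; [exists (inl y)|exists (inr y)].
by move=> x x' [u|v] _ _; [exact: R4|exact: S4].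
Qed.

Lemma small_set0 T : small_set (@set0 T).
Proof. by exists void; exact: card_ge0. Qed.

Lemma small_set1 T (x : T) : small_set [set x].
Proof.
by exists unit; apply: (@card_le_fun _ _ _ _ (fun=> tt)) => // ? ? -> ->.
Qed.

Definition V0 : V := node (of_void V).

Definition child (y x : V) : Prop := let: node _ f := x in exists a, f a = y.

Lemma child_irrefl x : ~ child x x.
Proof. by elim: x => A f IH [a e]; apply: (IH a); rewrite e; exists a. Qed.

Lemma wf_total_order (k : Type) :
  exists lt : k -> k -> Prop,
    well_founded lt /\ forall a b, a <> b -> lt a b \/ lt b a.
Proof.
elim/Peq: k => k; have [R Rwo] := well_ordering_principle k.
exists (fun a b => R a b /\ a <> b).
have min2 a b : R a b \/ R b a.
  have [|z [[]]] := Rwo (pred2 a b); first by exists a; rewrite inE eqxx.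
  rewrite inE => /orP[/eqP->|/eqP->] lb _; [left|right]; apply: lb.
    by rewrite inE eqxx orbT.
  by rewrite inE eqxx.
have anti a b : R a b -> R b a -> a = b.
  move=> ab ba; have [|z [_ zu]] := Rwo (pred2 a b).
    by exists a; rewrite inE eqxx.
  have refl c : R c c by case: (min2 c c).
  by rewrite -(zu a) ?(zu b) //; split; rewrite ?inE ?eqxx ?orbT // => y;
    rewrite inE => /orP[/eqP->|/eqP->].
split=> [a|a b ab]; last first.
  by case: (min2 a b) => h; [left|right]; split=> // e; apply: ab.
apply: contrapT => nAcc.
have [|z [[zN zmin] _]] := Rwo [pred x | `[< ~ Acc (fun a b => R a b /\ a <> b) x >]].
  by exists a; apply/asboolP.
move/asboolP: zN; apply; constructor => y [yz nyz].
apply: contrapT => nAy; apply: nyz; apply: anti => //.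
by apply: zmin; apply/asboolP.
Qed.

(** Any small type has a copy outside any small set Z: send a, by recursion
    along a well-order, to the tree whose immediate subtrees are the elements
    of Z and the images of the predecessors of a.  No tree is its own
    immediate subtree. *)
Lemma fresh_copy (k : Small) (Z : set V) : small_set Z ->
  exists g : k -> V, injective g /\ forall x, ~ Z (g x).
Proof.
move=> [l /card_leRP[R [_ R2 _ R4]]].
have /choice[e eP] : forall x : l, exists z, forall z', R z' x -> z' = z.
  move=> x; have [[z zx]|n] := pselect (exists z, R z x).
    by exists z => z' z'x; exact: R4 z'x zx.
  by exists V0 => z' z'x; case: n; exists z'.
have [lt [ltwf lttot]] := wf_total_order k.
pose body a (rec : forall b, lt b a -> V) : V :=
  node (fun x : l + {b : k | lt b a} =>
    match x with inl y => e y | inr (exist b ba) => rec b ba end).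
pose h := Fix ltwf (fun=> V) body.
have hE a : h a = body a (fun b _ => h b).
  rewrite /h Fix_eq // => x f g fg; congr (node _); apply/funext => -[//|[b bx]].
  exact: fg.
have child_lt a b : lt b a -> child (h b) (h a).
  by move=> ba; rewrite [h a]hE; exists (inr (exist _ b ba)).
have child_Z a z : Z z -> child z (h a).
  by move=> /R2[x zx]; rewrite hE; exists (inl x); rewrite /= (eP _ _ zx).
exists h; split=> [a b hab|a Zha]; last exact: (@child_irrefl (h a)) (child_Z _ _ Zha).
apply: contrapT => /lttot[/child_lt|/child_lt]; rewrite hab; exact: child_irrefl.
Qed.

Lemma fresh_inj T (A : set T) (Z : set V) : small_set A -> small_set Z ->
  exists g : T -> V, (forall x y, A x -> A y -> g x = g y -> x = y) /\
    forall x, A x -> ~ Z (g x).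
Proof.
move=> [k /card_leRP[R [_ R2 R3 R4]]] Zs; have [g [ginj gZ]] := fresh_copy k Zs.
have /choice[f fP] : forall x, exists y, A x -> exists2 u, R x u & y = g u.
  move=> x; have [Ax|nAx] := pselect (A x); last by exists V0.
  by have [u xu] := R2 _ Ax; exists (g u) => _; exists u.
exists f; split=> [x y Ax Ay|x Ax]; last by have [u _ ->] := fP _ Ax; exact: gZ.
have [u xu ->] := fP _ Ax; have [v yv ->] := fP _ Ay.
by move=> /ginj uv; apply: R4 xu _; rewrite uv.
Qed.

Lemma fresh_point (Z : set V) : small_set Z -> exists c, ~ Z c.
Proof.
move=> Zs; have [g [_ gZ]] := fresh_inj (small_set1 tt) Zs.
by exists (g tt); exact: gZ.
Qed.

(** * Models, abstract elementary classes and orbital types *)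

Section ModelTheory.
Variable tau : vocabulary.
Implicit Types (M N : model tau) (f g : V -> V).

Lemma model_eq M N : univ M = univ N ->
  (forall (R : predsym tau) (t : parity R -> V), rsem M t <-> rsem N t) ->
  (forall (F : funsym tau) (t : farity F -> V), fsem M t = fsem N t) -> M = N.
Proof.
case: M N => [UM rM fM r1 f1 f2] [UN rN fN r1' f1' f2'] /= e re fe.
have {}re : rM = rN.
  apply: functional_extensionality_dep => R.
  by apply/funext => t; apply/propext; exact: re.
have {}fe : fM = fN.
  by apply: functional_extensionality_dep => R; apply/funext => t; exact: fe.
by subst; congr Model; exact: Prop_irrelevance.
Qed.

Lemma submodel_refl M : submodel M M.
Proof. by split. Qed.

Lemma submodel_trans M1 M2 M3 : submodel M1 M2 -> submodel M2 M3 -> submodel M1 M3.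
Proof.
move=> [u1 r1 f1] [u2 r2 f2]; split=> [x /u1/u2//|R t tM|F t tM].
  by rewrite r1 // r2 // => i; apply: u1.
by rewrite f1 // f2 // => i; apply: u1.
Qed.

Lemma submodel_sub M1 M2 N : submodel M1 N -> submodel M2 N ->
  univ M1 `<=` univ M2 -> submodel M1 M2.
Proof.
move=> [u1 r1 f1] [u2 r2 f2] u12; split=> // [R t tM|F t tM].
  by rewrite r1 // r2 // => i; apply: u12.
by rewrite f1 // f2 // => i; apply: u12.
Qed.

Lemma submodel_anti M N : submodel M N -> submodel N M -> M = N.
Proof.
move=> [u1 r1 f1] [u2 r2 f2]; have e : univ M = univ N by apply/seteqP.
apply: model_eq => // [R t|F t].
  split=> h; first by apply/r1 => //; exact: rel_univ h.
  by apply/r2 => //; exact: rel_univ h.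
have [tM|tM] := pselect (tuple_in (univ M) t); first exact: f1.
by rewrite !fn_out -?e.
Qed.

Lemma submodel_eq M N : submodel M N -> univ N `<=` univ M -> M = N.
Proof.
move=> MN NM; apply: submodel_anti => //.
by apply: submodel_sub NM; [exact: submodel_refl|exact: MN].
Qed.

Lemma iso_in f M N x : model_iso f M N -> univ M x -> univ N (f x).
Proof. by move=> [[h _ _] _ _] /h. Qed.

Lemma iso_inj f M N x y : model_iso f M N -> univ M x -> univ M y ->
  f x = f y -> x = y.
Proof. by move=> [[_ h _] _ _] Mx My; apply: h; rewrite inE. Qed.

Lemma iso_surj f M N y : model_iso f M N -> univ N y ->
  exists2 x, univ M x & f x = y.
Proof. by move=> [[_ _ h] _ _] /h. Qed.

Lemma iso_univ f M N : model_iso f M N -> univ N = f @` univ M.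
Proof.
move=> i; apply/seteqP; split=> [y /(iso_surj i)//|_ [x Mx <-]].
exact: iso_in Mx.
Qed.

Lemma iso_tuple f M N (I : Small) (t : I -> V) :
  model_iso f M N -> tuple_in (univ M) t -> tuple_in (univ N) (f \o t).
Proof. by move=> i tM j; apply: iso_in i _; exact: tM. Qed.

Lemma iso_card f M N : model_iso f M N -> univ N #= univ M.
Proof. by move=> i; rewrite (iso_univ i); apply: inj_card_eq; case: i => -[]. Qed.

Lemma isoI f M N :
  (forall x, univ M x -> univ N (f x)) ->
  (forall x y, univ M x -> univ M y -> f x = f y -> x = y) ->
  (forall y, univ N y -> exists2 x, univ M x & f x = y) ->
  (forall (R : predsym tau) (t : parity R -> V), tuple_in (univ M) t ->
     (rsem M t <-> rsem N (f \o t))) ->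
  (forall (F : funsym tau) (t : farity F -> V), tuple_in (univ M) t ->
     fsem N (f \o t) = omap f (fsem M t)) ->
  model_iso f M N.
Proof.
by move=> fi finj fs fr ff; split=> //; split=> // x y; rewrite !inE; exact: finj.
Qed.

Lemma iso_id M : model_iso id M M.
Proof.
by apply: isoI => // [y My|F t tM]; [exists y|case: (fsem M t)].
Qed.

Lemma iso_comp f g M N P :
  model_iso f M N -> model_iso g N P -> model_iso (g \o f) M P.
Proof.
move=> i j; apply: isoI => [x Mx|x y Mx My /= /(iso_inj j) e|y Py|R t tM|F t tM].
- by apply: iso_in j _; exact: iso_in Mx.
- by apply: iso_inj (i) _ _ _ => //; apply: e; exact: iso_in i _.
- have [z Nz <-] := iso_surj j Py; have [x Mx <-] := iso_surj i Nz.
  by exists x.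
- case: (i) (j) => _ ri _ [_ rj _].
  by rewrite ri // rj //; exact: iso_tuple i tM.
- case: (i) (j) => _ _ fi [_ _ fj].
  rewrite -compA fj ?fi //; last exact: iso_tuple i tM.
  by case: (fsem M t).
Qed.

Lemma iso_eq f g M N : (forall x, univ M x -> f x = g x) ->
  model_iso f M N -> model_iso g M N.
Proof.
move=> fg i; apply: isoI => [x Mx|x y Mx My|y Ny|R t tM|F t tM].
- by rewrite -fg //; exact: iso_in Mx.
- by rewrite -!fg //; exact: iso_inj i _ _.
- by have [x Mx <-] := iso_surj i Ny; exists x => //; rewrite fg.
- have -> : g \o t = f \o t by apply/funext => j /=; rewrite fg.
  by case: i => _ h _; exact: h.
- have -> : g \o t = f \o t by apply/funext => j /=; rewrite fg.
  case: i => _ _ ->//; case: (pselect (exists y, fsem M t = Some y)).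
    move=> [y e]; rewrite e /= fg //; have [y' My'] := fn_univ tM.
    by rewrite e => -[->].
  by case: (fsem M t) => // y []; exists y.
Qed.

Lemma fn_val M (F : funsym tau) (t : farity F -> V) : tuple_in (univ M) t ->
  exists2 y, fsem M t = Some y & univ M y.
Proof. by move=> /fn_univ[y]; exists y. Qed.

Lemma iso_inv f M N : model_iso f M N ->
  exists g, [/\ model_iso g N M, forall x, univ M x -> g (f x) = x
              & forall y, univ N y -> f (g y) = y].
Proof.
move=> i.
have /choice[g gP] : forall y, exists x, univ N y -> univ M x /\ f x = y.
  move=> y; have [Ny|] := pselect (univ N y); last by exists V0.
  by have [x Mx <-] := iso_surj i Ny; exists x.
have gM y : univ N y -> univ M (g y) by move=> /gP[].
have fg y : univ N y -> f (g y) = y by move=> /gP[].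
have gf x : univ M x -> g (f x) = x.
  move=> Mx; have Nfx := iso_in i Mx.
  by apply: iso_inj i _ _ _ => //; [exact: gM|rewrite fg].
have fgt (I : Small) (t : I -> V) : tuple_in (univ N) t -> f \o (g \o t) = t.
  by move=> tN; apply/funext => j /=; rewrite fg.
have gt (I : Small) (t : I -> V) : tuple_in (univ N) t ->
  tuple_in (univ M) (g \o t) by move=> tN j; apply: gM.
exists g; split=> //; apply: isoI => // [x y Nx Ny e|y My|R t tN|F t tN].
- by rewrite -(fg x) // e fg.
- by exists (f y); [exact: iso_in My|exact: gf].
- case: i => _ h _; split=> [rt|]; last by rewrite h ?fgt//; exact: gt.
  by rewrite h ?fgt//; exact: gt.
- case: i => _ _ h; have := h _ _ (gt _ _ tN); rewrite fgt // => ->.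
  have [y -> My] := fn_val (gt _ _ tN).
  by rewrite /= gf.
Qed.

Lemma iso_submodel f M N M' N' : model_iso f N N' -> model_iso f M M' ->
  submodel M N -> submodel M' N'.
Proof.
move=> i j [u r h]; have u' : univ M' `<=` univ N'.
  move=> y /(iso_surj j)[x /u Nx <-]; exact: iso_in Nx.
have back (I : Small) (t : I -> V) : tuple_in (univ M') t ->
    exists2 t', tuple_in (univ M) t' & t = f \o t'.
  move=> tM'; have /choice[t' t'P] : forall z, exists x, univ M x /\ f x = t z.
    by move=> z; have [x] := iso_surj j (tM' z); exists x.
  by exists t' => [z|]; [case: (t'P z)|apply/funext => z /=; case: (t'P z)].
split=> // [R t /back[t' t'M ->]|F t /back[t' t'M ->]].
  case: i j => _ ri _ [_ rj _]; rewrite -rj // r // ri // => z.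
  by apply: u.
case: i j => _ _ ri [_ _ rj]; rewrite rj // h // ri // => z.
by apply: u.
Qed.

Lemma iso_image f M :
  (forall x y, univ M x -> univ M y -> f x = f y -> x = y) ->
  exists N, model_iso f M N.
Proof.
move=> finj.
have /choice[g gP] : forall y, exists x,
    (exists2 x, univ M x & f x = y) -> univ M x /\ f x = y.
  move=> y; have [[x Mx <-]|] := pselect (exists2 x, univ M x & f x = y).
    by exists x.
  by exists V0.
have gM y : (f @` univ M) y -> univ M (g y) by move=> /gP[].
have gf x : univ M x -> g (f x) = x.
  move=> Mx; have [Mg e] : univ M (g (f x)) /\ f (g (f x)) = f x.
    by apply: gP; exists x.
  exact: finj.
pose fs (F : funsym tau) (t : farity F -> V) :=
  if pselect (tuple_in (f @` univ M) t) then omap f (fsem M (g \o t)) else None.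
pose rs (R : predsym tau) (t : parity R -> V) :=
  tuple_in (f @` univ M) t /\ rsem M (g \o t).
have h1 R t : rs R t -> tuple_in (f @` univ M) t by case.
have h2 F (t : farity F -> V) : tuple_in (f @` univ M) t ->
    exists2 y, (f @` univ M) y & fs F t = Some y.
  move=> tf; rewrite /fs; case: pselect => [h|//]; rewrite {h}/=.
  have [|y -> My] := @fn_val M F (g \o t); first by move=> i; apply: gM.
  by exists (f y) => //; exists y.
have h3 F (t : farity F -> V) : ~ tuple_in (f @` univ M) t -> fs F t = None.
  by move=> nt; rewrite /fs; case: pselect.
exists (@Model tau (f @` univ M) rs fs h1 h2 h3).
have gft (I : Small) (t : I -> V) : tuple_in (univ M) t -> g \o (f \o t) = t.
  by move=> tM; apply/funext => j /=; rewrite gf.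
have ft (I : Small) (t : I -> V) : tuple_in (univ M) t ->
    tuple_in (f @` univ M) (f \o t) by move=> tM j; exists (t j).
apply: isoI => [x Mx|//|y //|R t tM|F t tM] /=; first by exists x.
  by rewrite /rs gft //; split=> [|[]//]; split=> //; exact: ft.
rewrite /fs; case: pselect => [h|[]]; last exact: ft.
by rewrite gft.
Qed.

End ModelTheory.

Section AecTheory.
Variables (tau : vocabulary) (k : aec tau) (lam : Small) (mu : option Small).
Hypothesis kA : ess_aec k lam mu.
Implicit Types (M N : model tau) (f g : V -> V).

Lemma card_below_small T (A : set T) : card_below mu A -> small_set A.
Proof.
by case: mu => [m [h _]|[m]]; [exists m|rewrite card_eq_le => /andP[h _]; exists m].
Qed.

Lemma inK_small M : inK k M -> small_set (univ M).
Proof. by move=> /(aec_card kA)[_ /card_below_small]. Qed.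

Lemma lek_univ M N : lek k M N -> univ M `<=` univ N.
Proof. by move=> /(aec_sub kA)[]. Qed.

Lemma lek_eq M N : lek k M N -> univ N `<=` univ M -> M = N.
Proof. by move=> /(aec_sub kA); exact: submodel_eq. Qed.

Lemma lek_coherence M1 M2 N : lek k M1 N -> lek k M2 N ->
  univ M1 `<=` univ M2 -> lek k M1 M2.
Proof.
move=> h1 h2 h; apply: (aec_coherence kA _ h1 h2).
exact: submodel_sub (aec_sub kA h1) (aec_sub kA h2) h.
Qed.

Lemma lek_iso f M N N' : lek k M N -> model_iso f N N' ->
  exists2 M', model_iso f M M' & lek k M' N'.
Proof.
move=> MN i; have [|M' j] := @iso_image _ f M.
  by move=> x y /(lek_univ MN) Nx /(lek_univ MN) Ny; exact: iso_inj i Nx Ny.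
exists M' => //; apply: (aec_isole kA MN i j).
exact: iso_submodel i j (aec_sub kA MN).
Qed.

Lemma lek_iso_id f M N N' : lek k M N -> model_iso f N N' ->
  (forall x, univ M x -> f x = x) -> lek k M N'.
Proof.
move=> MN i fid; have j : model_iso f M M.
  by apply: iso_eq (iso_id M) => x Mx; rewrite fid.
by apply: (aec_isole kA MN i j); exact: iso_submodel i j (aec_sub kA MN).
Qed.

Lemma emb_lek M N : lek k M N -> lek_embedding k id M N.
Proof. by exists M => //; exact: iso_id. Qed.

Lemma emb_iso f M N : inK k M -> model_iso f M N -> lek_embedding k f M N.
Proof.
by move=> KM i; exists N => //; apply: (aec_refl kA); exact: (aec_isoK kA i KM).
Qed.

Lemma emb_comp f g M N P : lek_embedding k f M N -> lek_embedding k g N P ->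
  lek_embedding k (g \o f) M P.
Proof.
move=> [M' fi M'N] [N' gi N'P]; have [M'' gi' h] := lek_iso M'N gi.
by exists M''; [exact: iso_comp fi gi'|exact: (aec_trans kA h N'P)].
Qed.

Lemma emb_subl f M M0 N : lek k M0 M -> lek_embedding k f M N ->
  lek_embedding k f M0 N.
Proof. by move=> /emb_lek h /(emb_comp h). Qed.

Lemma emb_in f M N x : lek_embedding k f M N -> univ M x -> univ N (f x).
Proof. by move=> [M' i /lek_univ h] Mx; apply: h; exact: iso_in Mx. Qed.

Lemma emb_lek_id f M N N' : lek k M N -> lek_embedding k f N N' ->
  (forall x, univ M x -> f x = x) -> lek k M N'.
Proof.
move=> MN [N1 i N1N'] /(lek_iso_id MN i) MN1.
exact: (aec_trans kA MN1 N1N').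
Qed.

(** Undo f on its image, and send the rest of N to a fresh copy. *)
Lemma emb_incl f M N (Z : set V) : lek_embedding k f M N -> small_set Z ->
  exists N' h, [/\ model_iso h N N', lek k M N',
    forall x, univ M x -> h (f x) = x & forall y, univ N' y -> Z y -> univ M y].
Proof.
move=> [M' i M'N] Zs; have [f' [i' f'f ff']] := iso_inv i.
have [KM' KN] := aec_leK kA M'N.
have Ms : small_set (univ M) by apply: inK_small; exact: (aec_isoK kA i' KM').
have [g [ginj gZ]] := fresh_inj (inK_small KN) (small_setU Zs Ms).
pose h x := if pselect (univ M' x) then f' x else g x.
have hM x : univ M' x -> h x = f' x by rewrite /h; case: pselect.
have hN x : ~ univ M' x -> h x = g x by rewrite /h; case: pselect.
have hj : model_iso h M' M by apply: iso_eq i' => x /hM.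
have gM x : univ N x -> ~ univ M (g x) by move=> /gZ h1 h2; apply: h1; right.
have [|N' hi] := @iso_image _ h N.
  move=> x y Nx Ny; have [M'x|nx] := pselect (univ M' x);
    have [M'y|ny] := pselect (univ M' y).
  - exact: iso_inj hj M'x M'y.
  - rewrite [h y]hN // => e; case: (gM _ Ny); rewrite -e; exact: iso_in M'x.
  - rewrite [h x]hN // => e; case: (gM _ Nx); rewrite e; exact: iso_in M'y.
  - by rewrite !hN //; exact: ginj.
exists N', h; split=> [//||x Mx|y].
- by apply: (aec_isole kA M'N hi hj); exact: iso_submodel hi hj (aec_sub kA M'N).
- by rewrite hM ?f'f //; exact: iso_in Mx.
- move=> /(iso_surj hi)[x Nx <-] Zhx.
  have [M'x|nx] := pselect (univ M' x); first exact: iso_in M'x.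
  by case: (gZ x Nx); left; rewrite -hN.
Qed.

Hypothesis kAP : amalgamation k.

(** Moving the amalgam makes the two embeddings the identity on M0. *)
Lemma amalgam_over M0 M1 M2 : lek k M0 M1 -> lek k M0 M2 ->
  exists N f1 f2, [/\ lek_embedding k f1 M1 N, lek_embedding k f2 M2 N,
    forall x, univ M0 x -> f1 x = x & forall x, univ M0 x -> f2 x = x].
Proof.
move=> h1 h2; have [N [f1 [f2 [e1 e2 e]]]] := kAP h1 h2.
have [N' [h [hi _ hid _]]] := emb_incl (emb_subl h1 e1) (small_set0 V).
have KN : inK k N by case: e1 => N1 _ /(aec_leK kA)[].
have he := emb_iso KN hi.
exists N', (h \o f1), (h \o f2); split=> [||//|x Mx /=].
- exact: emb_comp e1 he.
- exact: emb_comp e2 he.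
- by rewrite -e // hid.
Qed.

Lemma at_relI M N1 a1 N2 a2 N f1 f2 : lek k M N1 -> univ N1 a1 ->
  lek k M N2 -> univ N2 a2 ->
  lek_embedding k f1 N1 N -> lek_embedding k f2 N2 N ->
  (forall x, univ M x -> f1 x = x) -> (forall x, univ M x -> f2 x = x) ->
  f1 a1 = f2 a2 -> at_rel k (M, N1, a1) (M, N2, a2).
Proof. by move=> *; split=> //; exists N, f1, f2. Qed.

Lemma at_rel_sym t1 t2 : at_rel k t1 t2 -> at_rel k t2 t1.
Proof.
move: t1 t2 => [[M1 N1] a1] [[M2 N2] a2] [e [h1 h2] [h3 h4] [N [f1 [f2 []]]]].
by subst => *; apply: (@at_relI _ _ _ _ _ N f2 f1).
Qed.

(** The two extensions in which the pairs are identified are moved above N2 and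
    amalgamated over it. *)
Lemma at_rel_trans t1 t2 t3 : at_rel k t1 t2 -> at_rel k t2 t3 -> at_rel k t1 t3.
Proof.
move: t1 t2 t3 => [[M N1] a1] [[M2 N2] a2] [[M3 N3] a3].
move=> [eM [h1 a1N] [h2 a2N] [P [f1 [f2 [e1 e2 i1 i2 ea]]]]].
move=> [eM' _ [h3 a3N] [Q [g2 [g3 [e2' e3 j2 j3 eb]]]]].
move: eM eM' => eM eM'; move: h2 h3 i1 i2 j2 j3; subst => h2 h3 i1 i2 j2 j3.
have [P' [h [hi hN2 hid _]]] := emb_incl e2 (small_set0 V).
have [Q' [h' [hi' hN2' hid' _]]] := emb_incl e2' (small_set0 V).
have [R [u [v [eu ev uid vid]]]] := amalgam_over hN2 hN2'.
have KP : inK k P by case: e1 => ? _ /(aec_leK kA)[].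
have KQ : inK k Q by case: e3 => ? _ /(aec_leK kA)[].
have MN2 := lek_univ h2.
apply: (@at_relI _ _ _ _ _ R (u \o (h \o f1)) (v \o (h' \o g3))) => //.
- by apply: emb_comp eu; apply: emb_comp e1 _; exact: emb_iso.
- by apply: emb_comp ev; apply: emb_comp e3 _; exact: emb_iso.
- by move=> x Mx /=; rewrite i1 // -{1}(i2 x) // hid ?uid //; exact: MN2.
- by move=> x Mx /=; rewrite j3 // -{1}(j2 x) // hid' ?vid //; exact: MN2.
- by rewrite /= ea hid // -eb hid' // uid // vid.
Qed.

Lemma at_rel_refl M N a : lek k M N -> univ N a -> at_rel k (M, N, a) (M, N, a).
Proof.
move=> MN Na; have e : lek_embedding k id N N.
  by apply: emb_lek; apply: (aec_refl kA); case: (aec_leK kA MN).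
exact: (at_relI (N := N) (f1 := id) (f2 := id)).
Qed.

Lemma ortpP M N a t : lek k M N -> univ N a ->
  ortp k a M N t <-> at_rel k (M, N, a) t.
Proof.
move=> MN Na; split=> [h|h]; last exact: t_step.
rewrite /ortp /= in h; elim: h => [t1 t2 h|t1 t2 t3 _ h12 _ h23]; first exact: h.
exact: at_rel_trans h12 h23.
Qed.

Lemma ortp_eqP M N1 a1 N2 a2 : lek k M N1 -> univ N1 a1 ->
  lek k M N2 -> univ N2 a2 ->
  ortp k a1 M N1 = ortp k a2 M N2 <-> at_rel k (M, N1, a1) (M, N2, a2).
Proof.
move=> h1 a1N h2 a2N; split=> [e|h12].
  by apply/ortpP => //; rewrite e; apply/ortpP => //; exact: at_rel_refl.
apply/seteqP; split=> t /ortpP h; apply/ortpP => //.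
  by apply: at_rel_trans (h h1 a1N); exact: at_rel_sym.
by apply: at_rel_trans (h h2 a2N).
Qed.

Lemma ortp_emb f M N N' a : lek k M N -> univ N a -> lek_embedding k f N N' ->
  (forall x, univ M x -> f x = x) -> ortp k a M N = ortp k (f a) M N'.
Proof.
move=> MN Na e fid; have MN' := emb_lek_id MN e fid; have Nfa := emb_in e Na.
have KN' : inK k N' by case: (aec_leK kA MN').
apply/ortp_eqP => //; apply: (at_relI (N := N') (f1 := f) (f2 := id)) => //.
by apply: emb_lek; exact: (aec_refl kA KN').
Qed.

Lemma ortp_eq_sub M0 M N1 a1 N2 a2 : lek k M0 M -> lek k M N1 -> univ N1 a1 ->
  lek k M N2 -> univ N2 a2 -> ortp k a1 M N1 = ortp k a2 M N2 ->
  ortp k a1 M0 N1 = ortp k a2 M0 N2.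
Proof.
move=> h0 h1 a1N h2 a2N /ortp_eqP => /(_ h1 a1N h2 a2N).
move=> [_ _ _ [P [f1 [f2 [e1 e2 i1 i2 e]]]]].
have sub := lek_univ h0.
have [h01 h02] : lek k M0 N1 /\ lek k M0 N2 by split; exact: (aec_trans kA h0).
apply/ortp_eqP => //; apply: (at_relI (N := P) (f1 := f1) (f2 := f2)) => //.
  by move=> x /sub; exact: i1.
by move=> x /sub; exact: i2.
Qed.

Lemma restr_ortp M0 M N a : lek k M0 M -> lek k M N -> univ N a ->
  restr k (ortp k a M N) M0 = ortp k a M0 N.
Proof.
move=> h0 h Na; apply/seteqP; split=> t.
  move=> [M' [N' [a' [/(ortpP _ h Na) r]]]].
  have [e _ [h' Na'] _] := r; rewrite -e in h' r *.
  by rewrite (ortp_eq_sub h0 h Na h' Na') //; apply/ortp_eqP.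
move=> ht; exists M, N, a; split=> //; apply/ortpP => //; exact: at_rel_refl.
Qed.

End AecTheory.

Section FrameTheory.
Variables (tau : vocabulary) (s : frame tau) (lam : Small) (mu : option Small).
Hypothesis sG : good_frame s lam mu.
Let kA := gf_aec sG.
Let kAP := gf_ap sG.
Implicit Types (M N : model tau).

(** The embeddings that identify a and a' in a common extension P preserve
    non-forking, and monotonicity relates P to the two images inside it. *)
Lemma nf_ortp M0 M1 a N a' N' : nf s M0 M1 a N -> lek s M1 N' -> univ N' a' ->
  ortp s a M1 N = ortp s a' M1 N' -> nf s M0 M1 a' N'.
Proof.
move=> nfa h' Na'; have [[h01 h1] [Na _] _ _] := gf_nf_dom sG nfa.
move=> /(ortp_eqP kA kAP h1 Na h' Na').
move=> [_ _ _ [P [f1 [f2 [[N1 i1 l1] [N2 i2 l2] f1id f2id e]]]]].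
have lN1 := lek_iso_id kA h1 i1 f1id; have lN2 := lek_iso_id kA h' i2 f2id.
have sub := lek_univ kA h01.
have idM f : (forall x, univ M1 x -> f x = x) ->
    model_iso f M0 M0 /\ model_iso f M1 M1.
  by move=> fid; split; apply: iso_eq (iso_id _) => x Mx; rewrite fid //; exact: sub.
have [j0 j1] := idM f1 f1id.
have n1 : nf s M0 M1 (f1 a) N1 := gf_nf_iso sG h01 lN1 i1 j0 j1 nfa.
have r0 : lek s M0 M0 by apply: (aec_refl kA); case: (aec_leK kA h01).
have r1 : lek s M1 M1 by apply: (aec_refl kA); case: (aec_leK kA h01).
have [|nP nN] := gf_monotonicity sG (a := f1 a) r0 h01 r1 lN1 l1 _ l2.
  move=> x [/(lek_univ kA lN2)//|->]; rewrite e; exact: iso_in Na'.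
have n2 := nN.1 (nP n1).
have [g [gi gf fg]] := iso_inv i2.
have gid x : univ M1 x -> g x = x.
  by move=> Mx; rewrite -{1}(f2id x) // gf //; exact: (lek_univ kA h' Mx).
have [k0 k1] := idM g gid.
have := gf_nf_iso sG h01 h' gi k0 k1 n2.
by rewrite e gf.
Qed.

Lemma dnf_ortp M0 M N a : lek s M N -> univ N a ->
  dnf s (ortp s a M N) M M0 <-> nf s M0 M a N.
Proof.
move=> MN Na; split=> [[N' [a' [h' Na' e nf']]]|h]; last by exists N, a.
by apply: nf_ortp nf' MN Na _.
Qed.

End FrameTheory.

(** * Extended models and their witnesses *)

Section ExtModels.
Variables (lam : Small) (mu : option Small) (tau : vocabulary) (k : aec tau).
Variable E : seq_relation lam tau.
Hypothesis kA : ess_aec k lam mu.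
Hypothesis Esm : smooth k E.
Implicit Types (M N : model tau) (Ms Ns : model (ext_voc lam tau)).
Implicit Types (f : V -> V) (a b : lam -> V).

Lemma dom_E_l M a b : inK k M -> E M a b -> dom_E E M a.
Proof.
by move=> KM ab; exact: (sm_trans Esm KM ab (sm_sym Esm KM ab)).
Qed.

Lemma dom_E_r M a b : inK k M -> E M a b -> dom_E E M b.
Proof. by move=> KM /(sm_sym Esm KM)/(dom_E_l KM). Qed.

Lemma seq_of_univ M a : seq_of k M a -> tuple_in (univ M) a.
Proof.
move=> [M' e /(lek_univ kA) h] i; apply: h; rewrite e; by exists i.
Qed.

Lemma dom_univ M a : inK k M -> dom_E E M a -> tuple_in (univ M) a.
Proof. by move=> KM /(sm_dom Esm KM)/seq_of_univ. Qed.

Lemma E_lek M N a b : lek k M N -> E M a b -> E N a b.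
Proof. by move=> MN; case/(sm_restr Esm a b MN). Qed.

(** By coherence, what makes a tuple from M a member of seq(N) makes it a member
    of seq(M). *)
Lemma E_lek_back M N a b : lek k M N ->
  tuple_in (univ M) a -> tuple_in (univ M) b -> E N a b -> E M a b.
Proof.
move=> MN aM bM ab; have [_ KN] := aec_leK kA MN.
have down c : tuple_in (univ M) c -> dom_E E N c -> seq_of k M c.
  move=> cM /(sm_dom Esm KN)[M' e M'N]; exists M' => //.
  by apply: (lek_coherence kA M'N MN); rewrite e => _ [i _ <-].
apply/(sm_restr Esm a b MN); split=> //.
  by apply: down => //; exact: dom_E_l ab.
by apply: down => //; exact: dom_E_r ab.
Qed.

(** The default V0 is never taken on the arguments of interest: models interpret
    constants, and functions on tuples of their universe. *)
Definition cval Ms : V := odflt V0 (fsem_c Ms).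
Definition val_F Ms a : V := odflt V0 (fsem_F Ms a).

Lemma cvalE Ms : fsem_c Ms = Some (cval Ms).
Proof.
rewrite /cval /fsem_c; have [|y _ ->//] := @fn_univ _ Ms (Cstar _) (of_void V).
by case.
Qed.

Lemma cval_univ Ms : univ Ms (cval Ms).
Proof.
rewrite /cval /fsem_c; have [|y Uy -> //] := @fn_univ _ Ms (Cstar _) (of_void V).
by case.
Qed.

Lemma val_FE Ms a : tuple_in (univ Ms) a -> fsem_F Ms a = Some (val_F Ms a).
Proof.
move=> aU; rewrite /val_F /fsem_F.
by have [y _ ->] := @fn_univ _ Ms (Fstar _) a aU.
Qed.

Lemma witness_unique Ms M N : witness k E Ms M -> witness k E Ms N -> M = N.
Proof.
move=> wM wN; have e : univ M = univ N by rewrite (w_P wM) (w_P wN).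
apply: model_eq => // [R t|F t].
  by rewrite -(w_rel wM) -(w_rel wN).
have [tM|tM] := pselect (tuple_in (univ M) t); last by rewrite !fn_out // -e.
by rewrite -(w_fn wM) // -(w_fn wN) // -e.
Qed.

Section Witness.
Variables (Ms : model (ext_voc lam tau)) (M : model tau).
Hypothesis w : witness k E Ms M.
Let KM := w_K w.

Lemma w_univ : univ M `<=` univ Ms.
Proof. by rewrite (w_P w) => x /rel_univ /(_ tt). Qed.

Lemma w_tuple (I : Small) (t : I -> V) :
  tuple_in (univ M) t -> tuple_in (univ Ms) t.
Proof. by move=> tM i; apply: w_univ. Qed.

Lemma w_dom a : dom_E E M a -> tuple_in (univ Ms) a.
Proof. by move=> /(dom_univ KM)/w_tuple. Qed.

Lemma w_cval : ~ univ M (cval Ms).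
Proof. by apply: (w_c w); exact: cvalE. Qed.

Lemma w_val a : dom_E E M a ->
  [/\ univ Ms (val_F Ms a), ~ univ M (val_F Ms a) & val_F Ms a <> cval Ms].
Proof.
move=> aD; have : (fsem_F Ms @` dom_E E M) (fsem_F Ms a) by exists a.
rewrite (w_F_onto w) (val_FE (w_dom aD)) => -[y [Uy nMy ny] [<-]].
by split=> // e; apply: ny; rewrite e; exact: cvalE.
Qed.

Lemma w_val_eq a b : dom_E E M a -> dom_E E M b ->
  val_F Ms a = val_F Ms b <-> E M a b.
Proof.
move=> aD bD; rewrite -(w_F_eq w aD bD) (val_FE (w_dom aD)) (val_FE (w_dom bD)).
by split=> [->|[]].
Qed.

Lemma w_cases y : univ Ms y ->
  [\/ univ M y, y = cval Ms | exists2 a, dom_E E M a & val_F Ms a = y].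
Proof.
move=> Uy; have [My|nMy] := pselect (univ M y); first exact: Or31.
have [e|ne] := pselect (y = cval Ms); first exact: Or32.
apply: Or33; have : (Some @` [set y | [/\ univ Ms y, ~ univ M y
    & fsem_c Ms <> Some y]]) (Some y).
  by exists y => //; split=> //; rewrite cvalE => -[/esym].
by rewrite -(w_F_onto w) => -[a aD e]; exists a => //; rewrite /val_F e.
Qed.

End Witness.

Lemma submodel_cval Ms Ns : submodel Ms Ns -> cval Ms = cval Ns.
Proof.
move=> [_ _ h]; rewrite /cval /fsem_c; congr (odflt _ _).
by apply: (h (Cstar _)); case.
Qed.

Lemma submodel_val Ms Ns a : submodel Ms Ns -> tuple_in (univ Ms) a ->
  val_F Ms a = val_F Ns a.
Proof.
by move=> [_ _ h] aU; rewrite /val_F /fsem_F; congr (odflt _ _); apply: (h (Fstar _)).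
Qed.

(** The new elements of the smaller model stay new in the larger one. *)
Lemma w_inter Ms Ns M N : witness k E Ms M -> witness k E Ns N ->
  lek k M N -> cval Ms = cval Ns ->
  (forall a, dom_E E M a -> val_F Ms a = val_F Ns a) ->
  forall x, univ Ms x -> univ N x -> univ M x.
Proof.
move=> wM wN MN ec ev x /(w_cases wM)[//|->|[a aD <-]].
  by rewrite ec => /(w_cval wN).
by rewrite ev // => h; case: (w_val wN (E_lek MN aD)).
Qed.

(** A new element of Ms is new in Ns too, so tuples not from M are not from N,
    and both models send them to the common constant. *)
Lemma ext_submodel Ms Ns M N : witness k E Ms M -> witness k E Ns N ->
  lek k M N -> cval Ms = cval Ns ->
  (forall a, dom_E E M a -> val_F Ms a = val_F Ns a) -> submodel Ms Ns.
Proof.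
move=> wM wN MN ec ev; have inter := w_inter wM wN MN ec ev.
have [uMN rMN fMN] := aec_sub kA MN.
have sub : univ Ms `<=` univ Ns.
  move=> x /(w_cases wM)[/uMN/(w_univ wN)//|->|[a aD <-]].
    by rewrite ec; exact: cval_univ.
  by rewrite ev //; case: (w_val wN (E_lek MN aD)).
have back (I : Small) (t : I -> V) : tuple_in (univ Ms) t ->
    tuple_in (univ N) t -> tuple_in (univ M) t.
  by move=> tU tN i; exact: inter.
split=> // [[R|] t tU|[F||] t tU].
- rewrite -[rsem Ms t]/(rsem_old Ms t) -[rsem Ns t]/(rsem_old Ns t).
  rewrite (w_rel wM) (w_rel wN); split=> h.
    by apply/rMN => //; exact: rel_univ h.
  by apply/rMN => //; apply: back tU _; exact: rel_univ h.
- have -> : t = (fun=> t tt) by apply/funext => -[].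
  have := w_P wM; have := w_P wN => /(congr1 (@^~ (t tt))) e1 /(congr1 (@^~ (t tt))) e2.
  rewrite -[rsem Ms _]/(rsem_P Ms (t tt)) -[rsem Ns _]/(rsem_P Ns (t tt)) -e1 -e2.
  by split=> [/uMN//|]; exact: inter (tU tt).
- rewrite -[LHS]/(fsem_old Ms t) -[RHS]/(fsem_old Ns t).
  have [tM|ntM] := pselect (tuple_in (univ M) t).
    by rewrite (w_fn wM) // (w_fn wN) ?fMN // => i; apply: uMN.
  rewrite (w_fn_out wM) // (w_fn_out wN) ?cvalE ?ec //.
    by move=> i; apply: sub.
  by move=> /(back _ _ tU).
- rewrite -[LHS]/(fsem_F Ms t) -[RHS]/(fsem_F Ns t).
  have [tD|ntD] := pselect (dom_E E M t).
    by rewrite !val_FE ?ev // => i; apply: sub.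
  rewrite (w_F_out wM) // (w_F_out wN) ?cvalE ?ec //.
    by move=> i; apply: sub.
  move=> tD; apply: ntD; have tM := back _ _ tU (dom_univ (w_K wN) tD).
  exact: E_lek_back tD.
- have -> : t = of_void V by apply/funext => -[].
  by rewrite -[LHS]/(fsem_c Ms) -[RHS]/(fsem_c Ns) !cvalE ec.
Qed.

Let X := ext_aec k E.

Lemma lekX Ms Ns M N : lek X Ms Ns -> witness k E Ms M -> witness k E Ns N ->
  lek k M N.
Proof.
move=> [_ [M' [N' [wM' wN' MN']]]] wM wN.
by rewrite (witness_unique wM wM') (witness_unique wN wN').
Qed.

Lemma lekX_sub Ms Ns : lek X Ms Ns -> submodel Ms Ns.
Proof. by case. Qed.

Lemma lekX_cval Ms Ns : lek X Ms Ns -> cval Ms = cval Ns.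
Proof. by move=> [/submodel_cval e _]. Qed.

Lemma lekX_val Ms Ns M a : lek X Ms Ns -> witness k E Ms M -> dom_E E M a ->
  val_F Ms a = val_F Ns a.
Proof. by move=> [h _] w aD; apply: submodel_val h _; exact: w_dom aD. Qed.

Lemma lekXI Ms Ns M N : witness k E Ms M -> witness k E Ns N ->
  lek k M N -> cval Ms = cval Ns ->
  (forall a, dom_E E M a -> val_F Ms a = val_F Ns a) -> lek X Ms Ns.
Proof.
move=> wM wN MN ec ev; split; last by exists M, N.
exact: ext_submodel wM wN MN ec ev.
Qed.

Lemma lekX_w Ms Ns : lek X Ms Ns ->
  exists M N, [/\ witness k E Ms M, witness k E Ns N & lek k M N].
Proof. by case. Qed.

End ExtModels.

(** * Existence of extended models *)

Section ExtExistence.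
Variables (lam : Small) (mu : option Small) (tau : vocabulary) (k : aec tau).
Variable E : seq_relation lam tau.
Hypothesis laminf : infinite_set [set: lam].
Hypothesis kA : ess_aec k lam mu.
Hypothesis Esm : smooth k E.
Hypothesis Esmall : small_E k E.
Implicit Types (M N : model tau) (Ms Ns : model (ext_voc lam tau)).
Implicit Types (f : V -> V) (a b : lam -> V).
Let X := ext_aec k E.

Lemma inK_infinite M : inK k M -> infinite_set (univ M).
Proof.
move=> /(aec_card kA)[lM _]; apply/infiniteP; apply: card_le_trans lM.
exact/infiniteP.
Qed.

Lemma E_class_eq M a b : inK k M -> dom_E E M a -> dom_E E M b ->
  [set c | E M a c] = [set c | E M b c] <-> E M a b.
Proof.
move=> KM aD bD; split=> [e|ab].
  suff : [set c | E M a c] b by [].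
  by rewrite e.
have ba := sm_sym Esm KM ab.
by apply/seteqP; split=> c /= h; [exact: (sm_trans Esm KM ba)|exact: (sm_trans Esm KM ab)].
Qed.

(** The new elements are the constant and one element for each of the at most
    |M| classes. *)
Lemma w_card Ms M : witness k E Ms M -> univ Ms #= univ M.
Proof.
move=> w; have KM := w_K w; rewrite card_eq_le; apply/andP; split; last first.
  by apply: subset_card_le; exact: w_univ w.
have Minf := inK_infinite KM.
apply: (@card_le_trans _ _ _ (univ M `|` ([set cval Ms] `|` (val_F Ms @` dom_E E M)))).
  apply: subset_card_le => y /(w_cases w)[My|->|[a aD <-]]; [by left|by right; left|].
  by right; right; exists a.
apply: (card_leU Minf); first exact: (card_lexx (univ M)).
apply: (card_leU Minf).
  have [f [_ fM]] := infinite_seq Minf.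
  by apply: (@card_le_fun _ _ _ _ (fun=> f 0)) => // x y -> ->.
apply: card_le_trans (Esmall KM).
apply: (@card_leR _ _ _ _ (fun y C => exists2 a, dom_E E M a &
  val_F Ms a = y /\ C = [set b | E M a b])).
  by move=> _ [a aD <-]; exists [set b | E M a b]; exists a.
move=> x x' C _ _ [a aD [<- ->]] [b bD [<- /(E_class_eq KM aD bD)]].
by move=> /(w_val_eq kA Esm w aD bD).
Qed.

Lemma w_small Ms M : witness k E Ms M -> small_set (univ Ms).
Proof.
move=> w; apply: small_set_le (inK_small kA (w_K w)).
by have := w_card w; rewrite card_eq_le => /andP[].
Qed.

Section Build.
Variables (M : model tau) (c : V) (phi : (lam -> V) -> V).
Hypothesis KM : inK k M.
Hypothesis cM : ~ univ M c.
Hypothesis phiM : forall a, dom_E E M a -> ~ univ M (phi a) /\ phi a <> c.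
Hypothesis phiE : forall a b, dom_E E M a -> dom_E E M b ->
  phi a = phi b <-> E M a b.

Let U : set V := univ M `|` [set c] `|` (phi @` dom_E E M).

Let rel (R : ext_predsym tau) : set (ext_par R -> V) :=
  match R return set (ext_par R -> V) with
  | OldP R => fun t => rsem M t
  | Pstar => fun t => univ M (t tt)
  end.

Let val (F : ext_funsym tau) : (ext_far lam F -> V) -> V :=
  match F return (ext_far lam F -> V) -> V with
  | OldF F => fun t => odflt c (fsem M t)
  | Fstar => fun a => if pselect (dom_E E M a) then phi a else c
  | Cstar => fun _ => c
  end.

Let fn (F : ext_funsym tau) (t : ext_far lam F -> V) : option V :=
  if pselect (tuple_in U t) then Some (val t) else None.

Let rel_U R (t : ext_par R -> V) : rel t -> tuple_in U t.
Proof.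
case: R t => [R|] t /= h i; left; left; first exact: rel_univ h i.
by case: i.
Qed.

Let val_U F (t : ext_far lam F -> V) : tuple_in U t -> U (val t).
Proof.
have cU : U c by left; right.
case: F t => [F||] t tU //=.
  have [tM|tM] := pselect (tuple_in (univ M) t); last by rewrite fn_out.
  by have [y -> My] := fn_val tM; left; left.
by case: pselect => // tD; right; exists t.
Qed.

Let fn_U F (t : ext_far lam F -> V) : tuple_in U t ->
  exists2 y, U y & fn t = Some y.
Proof.
move=> tU; exists (val t); first exact: val_U.
by rewrite /fn; case: pselect.
Qed.

Let fn_nU F (t : ext_far lam F -> V) : ~ tuple_in U t -> fn t = None.
Proof. by rewrite /fn; case: pselect. Qed.

Let B : model (ext_voc lam tau) := @Model (ext_voc lam tau) U rel fn rel_U fn_U fn_nU.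

Let fnE F (t : ext_far lam F -> V) : tuple_in U t -> fn t = Some (val t).
Proof. by rewrite /fn; case: pselect. Qed.

Let MU : univ M `<=` U. Proof. by move=> x Mx; left; left. Qed.

Let domU a : dom_E E M a -> tuple_in U a.
Proof. by move=> /(dom_univ kA Esm KM) aM i; apply: MU. Qed.

Let B_c : fsem_c B = Some c.
Proof.
by rewrite -[fsem_c B]/(fn (of_void V : ext_far lam (Cstar tau) -> V)) fnE // => -[].
Qed.

Let B_F a : dom_E E M a -> fsem_F B a = Some (phi a).
Proof.
move=> aD; rewrite -[fsem_F B a]/(fn (a : ext_far lam (Fstar tau) -> V)) fnE /=.
  by case: pselect.
exact: domU.
Qed.

(** The extension of M with prescribed new elements: the constant c, and
    phi a for the class of a. *)
Lemma ext_build : exists Ms, [/\ witness k E Ms M, cval Ms = c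
  & forall a, dom_E E M a -> val_F Ms a = phi a].
Proof.
exists B; split; last 2 first.
- by rewrite /cval B_c.
- by move=> a aD; rewrite /val_F B_F.
split=> //.
- move=> F t tM; rewrite -[LHS]/(fn (t : ext_far lam (OldF F) -> V)) fnE /=.
    by have [y -> _] := fn_val tM.
  by move=> i; apply: MU.
- move=> F t tU tM; rewrite B_c -[LHS]/(fn (t : ext_far lam (OldF F) -> V)) fnE //=.
  by rewrite fn_out.
- by move=> d; rewrite B_c => -[<-].
- apply/seteqP; split=> [_ [a aD <-]|_ [y [Uy nMy ny] <-]].
    rewrite B_F //; have [nM nc] := phiM aD; exists (phi a) => //; split=> //.
      by right; exists a.
    by rewrite B_c => -[/esym].
  move: Uy => [[//|yc]|[a aD e]]; first by case: ny; rewrite B_c yc.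
  by exists a => //; rewrite B_F // e.
- move=> a b aD bD; rewrite !B_F //; rewrite -phiE //.
  by split=> [[]|->].
- move=> a aU aD; rewrite B_c -[LHS]/(fn (a : ext_far lam (Fstar tau) -> V)) fnE //=.
  by case: pselect.
Qed.

End Build.

(** Some of the new elements may be prescribed, namely psi a for the class of a
    when a is in D; the other classes get fresh elements. *)
Lemma ext_exists N (c : V) (D : set (lam -> V)) (psi : (lam -> V) -> V) :
  inK k N -> ~ univ N c -> D `<=` dom_E E N ->
  (forall a, D a -> ~ univ N (psi a) /\ psi a <> c) ->
  (forall a b, D a -> D b -> psi a = psi b <-> E N a b) ->
  small_set (psi @` D) ->
  exists Ns, [/\ witness k E Ns N, cval Ns = c
               & forall a, D a -> val_F Ns a = psi a].
Proof.
move=> KN cN DN psiN psiE psis.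
have cs : small_set (E_classes E N).
  exact: small_set_le (Esmall KN) (inK_small kA KN).
have [g [ginj gZ]] := fresh_inj cs
  (small_setU (small_setU (inK_small kA KN) (small_set1 c)) psis).
have gZ' a : dom_E E N a -> [/\ ~ univ N (g [set b | E N a b]),
    g [set b | E N a b] <> c & forall b, D b -> g [set b | E N a b] <> psi b].
  move=> aD; have h := gZ [set b | E N a b] (ex_intro2 _ _ a aD erefl).
  split=> [?|e|b Db e]; apply: h; [by left; left|by left; right|].
  by right; exists b.
have /choice[phi phiP] : forall a, exists y, dom_E E N a ->
    (exists b, [/\ D b, E N a b & y = psi b]) \/
    ((forall b, D b -> ~ E N a b) /\ y = g [set b | E N a b]).
  move=> a; have [[b [Db ab]]|n] := pselect (exists b, D b /\ E N a b).
    by exists (psi b) => _; left; exists b.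
  exists (g [set b | E N a b]) => _; right; split=> // b Db ab.
  by apply: n; exists b.
have sym a b : E N a b -> E N b a by exact: (sm_sym Esm KN).
have trans a b d : E N a b -> E N b d -> E N a d by exact: (sm_trans Esm KN).
have [|a b aD bD|Ns [w ec ev]] := @ext_build N c phi KN cN.
- move=> a aD; case: (phiP _ aD) => [[b [Db _ ->]]|[_ ->]]; first exact: psiN.
  by case: (gZ' _ aD).
- case: (phiP _ aD) (phiP _ bD) => [[a' [Da aa' ->]]|[na ->]]
    [[b' [Db bb' ->]]|[nb ->]].
  + rewrite psiE //; split=> h; first exact: trans aa' (trans _ _ _ h (sym _ _ bb')).
    exact: trans (sym _ _ aa') (trans _ _ _ h bb').
  + split=> [e|ab]; first by case: (gZ' _ bD) => _ _ /(_ _ Da); rewrite e.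
    by case: (nb _ Da); exact: trans (sym _ _ ab) aa'.
  + split=> [e|ab]; first by case: (gZ' _ aD) => _ _ /(_ _ Db); rewrite e.
    by case: (na _ Db); exact: trans ab bb'.
  + rewrite -(E_class_eq KN aD bD); split=> [|->//].
    by apply: ginj; [exists a|exists b].
exists Ns; split=> // a Da; rewrite ev; last exact: DN.
case: (phiP _ (DN _ Da)) => [[b [Db ab ->]]|[n _]].
  by apply/psiE => //; exact: sym.
by case: (n _ Da); exact: DN.
Qed.

Lemma ext_any M : inK k M -> exists Ms, witness k E Ms M.
Proof.
move=> KM; have [c cM] := fresh_point (inK_small kA KM).
have [||||Ms [w _ _]] := @ext_exists M c set0 (fun=> V0) KM cM => //.
  by rewrite image_set0; exact: small_set0.
by exists Ms.
Qed.

(** Keep the constant of Ns and the values of its function on Dom(E_M). *)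
Lemma ext_restrict Ns M N : witness k E Ns N -> lek k M N ->
  exists Ms, witness k E Ms M /\ lek X Ms Ns.
Proof.
move=> w MN; have [KM _] := aec_leK kA MN; have sub := lek_univ kA MN.
have up a : dom_E E M a -> dom_E E N a by exact: (E_lek Esm MN).
have [|||||Ms [wM ec ev]] := @ext_exists M (cval Ns) (dom_E E M) (val_F Ns) KM => //.
- by move=> /sub; exact: w_cval w.
- by move=> a /up /(w_val kA Esm w)[_ h1 h2]; split=> // /sub.
- move=> a b aD bD; rewrite (w_val_eq kA Esm w (up _ aD) (up _ bD)).
  split; last exact: (E_lek Esm MN).
  by apply: (E_lek_back kA Esm MN); exact: (dom_univ kA Esm KM).
- apply: small_set_le (w_small w); apply: subset_card_le => _ [a /up aD <-].
  by case: (w_val kA Esm w aD).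
by exists Ms; split=> //; exact: (lekXI kA Esm wM w).
Qed.

(** The universe of N may meet the new elements of Ms, so N has to be moved
    over M. *)
Lemma ext_extend Ms M N : witness k E Ms M -> lek k M N ->
  exists N' Ns h, [/\ model_iso h N N', witness k E Ns N', lek k M N',
    lek X Ms Ns & forall x, univ M x -> h x = x].
Proof.
move=> w MN; have [N' [h [hi MN' hid hZ]]] := emb_incl kA (emb_lek MN) (w_small w).
have [KM KN'] := aec_leK kA MN'; have sub := lek_univ kA MN'.
have up a : dom_E E M a -> dom_E E N' a by exact: (E_lek Esm MN').
have [||||Ns [wN ec ev]] := @ext_exists N' (cval Ms) (dom_E E M) (val_F Ms) KN' _ up.
- by move=> /hZ /(_ (cval_univ Ms)); exact: w_cval w.
- move=> a /(w_val kA Esm w)[h1 h2 h3]; split=> // h4.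
  by apply: h2; exact: hZ.
- move=> a b aD bD; rewrite (w_val_eq kA Esm w aD bD).
  split; first exact: (E_lek Esm MN').
  by apply: (E_lek_back kA Esm MN'); exact: (dom_univ kA Esm KM).
- apply: small_set_le (w_small w); apply: subset_card_le => _ [a aD <-].
  by case: (w_val kA Esm w aD).
exists N', Ns, h; split=> //; apply: (lekXI kA Esm w wN MN') => // a aD.
by rewrite ev.
Qed.

End ExtExistence.

(** * Extending and restricting maps *)

Section ExtMaps.
Variables (lam : Small) (mu : option Small) (tau : vocabulary) (k : aec tau).
Variable E : seq_relation lam tau.
Hypothesis laminf : infinite_set [set: lam].
Hypothesis kA : ess_aec k lam mu.
Hypothesis Esm : smooth k E.
Hypothesis Esmall : small_E k E.
Implicit Types (M N : model tau) (Ms Ns : model (ext_voc lam tau)).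
Implicit Types (f : V -> V) (a b : lam -> V).
Let X := ext_aec k E.

Lemma iso_E f M N a b : inK k M -> model_iso f M N ->
  tuple_in (univ M) a -> tuple_in (univ M) b -> E M a b <-> E N (f \o a) (f \o b).
Proof. by move=> KM i; apply: (sm_iso Esm KM (aec_isoK kA i KM) i). Qed.

Lemma iso_dom f M N a : inK k M -> model_iso f M N ->
  dom_E E M a -> dom_E E N (f \o a).
Proof.
move=> KM i aD; have aM := dom_univ kA Esm KM aD.
exact: (iso_E KM i aM aM).1.
Qed.

(** The last two equations leave no choice on the new elements, and they define
    a bijection because E is invariant. *)
Lemma ext_iso f Ms Ns M N : witness k E Ms M -> witness k E Ns N ->
  model_iso f M N -> exists fs, [/\ model_iso fs Ms Ns,
    forall x, univ M x -> fs x = f x, fs (cval Ms) = cval Ns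
    & forall a, dom_E E M a -> fs (val_F Ms a) = val_F Ns (f \o a)].
Proof.
move=> wM wN i; have [KM KN] := (w_K wM, w_K wN).
have /choice[fs fsP] : forall x, exists y, univ Ms x ->
    [\/ univ M x /\ y = f x, x = cval Ms /\ y = cval Ns
      | exists a, [/\ dom_E E M a, x = val_F Ms a & y = val_F Ns (f \o a)]].
  move=> x; have [Ux|] := pselect (univ Ms x); last by exists V0.
  have [Mx|->|[a aD <-]] := w_cases wM Ux.
  - by exists (f x) => _; exact: Or31.
  - by exists (cval Ns) => _; exact: Or32.
  - by exists (val_F Ns (f \o a)) => _; apply: Or33; exists a.
have wcM := w_cval wM; have wvM := w_val kA Esm wM.
have fsM x : univ M x -> fs x = f x.
  move=> Mx; have [[]//|[e _]|[a [/wvM[_ h _] e _]]] := fsP _ (w_univ wM Mx).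
    by rewrite e in Mx.
  by rewrite -e in h.
have fsc : fs (cval Ms) = cval Ns.
  have [[/wcM]//|[]//|[a [/wvM[_ _ h] e _]]] := fsP _ (cval_univ Ms).
  by rewrite -e in h.
have fsv a : dom_E E M a -> fs (val_F Ms a) = val_F Ns (f \o a).
  move=> aD; have [U nM nc] := wvM _ aD; have [[//]|[//]|[b [bD e ->]]] := fsP _ U.
  apply/(w_val_eq kA Esm wN); [exact: iso_dom i _|exact: iso_dom i _|].
  apply/(iso_E KM i); [exact: (dom_univ kA Esm)|exact: (dom_univ kA Esm)|].
  by apply/(w_val_eq kA Esm wM).
have backD b : dom_E E N b -> exists2 a, dom_E E M a & f \o a = b.
  move=> bD; have bN := dom_univ kA Esm KN bD.
  have [g [gi gf fg]] := iso_inv i; exists (g \o b); first exact: iso_dom gi bD.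
  by apply/funext => j /=; rewrite fg.
have fs_in x : univ Ms x -> univ Ns (fs x).
  move=> /(w_cases wM)[Mx|->|[a aD <-]].
  - by rewrite fsM //; apply: (w_univ wN); exact: iso_in Mx.
  - by rewrite fsc; exact: cval_univ.
  - by rewrite fsv //; case: (w_val kA Esm wN (iso_dom KM i aD)).
have fs_inM x : univ Ms x -> univ N (fs x) -> univ M x.
  move=> /(w_cases wM)[//|->|[a aD <-]].
    by rewrite fsc => /(w_cval wN).
  by rewrite fsv //; case: (w_val kA Esm wN (iso_dom KM i aD)).
exists fs; split=> //; apply: isoI => //.
- move=> x y Ux Uy.
  have [Mx|nMx] := pselect (univ M x).
    move=> e; have My : univ M y.
      by apply: fs_inM => //; rewrite -e fsM //; exact: iso_in Mx.
    by apply: (iso_inj i Mx My); rewrite -(fsM _ Mx) -(fsM _ My).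
  have [//|->|[a aD <-]] := w_cases wM Ux; have [My|->|[b bD <-]] := w_cases wM Uy => //.
  + move=> e; case: (w_cval wM); apply: fs_inM; first exact: cval_univ.
    by rewrite e fsM //; exact: iso_in My.
  + by rewrite fsc fsv // => /esym e; case: (w_val kA Esm wN (iso_dom KM i bD)).
  + move=> e; case: (wvM _ aD) => U + _; case; apply: fs_inM => //.
    by rewrite e fsM //; exact: iso_in My.
  + by rewrite fsc fsv // => e; case: (w_val kA Esm wN (iso_dom KM i aD)).
  + rewrite !fsv // => /(w_val_eq kA Esm wN (iso_dom KM i aD) (iso_dom KM i bD)).
    move=> h; apply/(w_val_eq kA Esm wM) => //; apply/(iso_E KM i) => //.
      exact: (dom_univ kA Esm KM).
    exact: (dom_univ kA Esm KM).
- move=> y /(w_cases wN)[Ny|->|[b /backD[a aD <-] <-]].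
  + have [x Mx <-] := iso_surj i Ny; exists x; first exact: (w_univ wM).
    by rewrite fsM.
  + by exists (cval Ms) => //; exact: cval_univ.
  + by exists (val_F Ms a); [case: (wvM _ aD)|rewrite fsv].
- move=> [R|] t tU.
    rewrite -[rsem Ms t]/(rsem_old Ms t) -[rsem Ns _]/(rsem_old Ns (fs \o t)).
    rewrite (w_rel wM) (w_rel wN).
    have [tM|ntM] := pselect (tuple_in (univ M) t).
      have -> : fs \o t = f \o t by apply/funext => j /=; rewrite fsM.
      by case: i => _ h _; exact: h.
    split=> [/rel_univ//|/rel_univ h]; case: ntM => j.
    exact: fs_inM (tU j) (h j).
  have -> : t = (fun=> t tt) by apply/funext => -[].
  have := w_P wM; have := w_P wN => /(congr1 (@^~ (fs (t tt)))) e1 /(congr1 (@^~ (t tt))) e2.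
  rewrite -[rsem Ms _]/(rsem_P Ms (t tt)) -[rsem Ns _]/(rsem_P Ns (fs (t tt))) -e1 -e2.
  split=> [Mt|]; last exact: fs_inM (tU tt).
  by rewrite fsM //; exact: iso_in Mt.
- have fst (I : Small) (t : I -> V) : tuple_in (univ Ms) t ->
    tuple_in (univ Ns) (fs \o t) by move=> tU j; exact: fs_in.
  move=> [F||] t tU.
  + rewrite -[fsem Ms t]/(fsem_old Ms t) -[LHS]/(fsem_old Ns (fs \o t)).
    have [tM|ntM] := pselect (tuple_in (univ M) t).
      have e : fs \o t = f \o t by apply/funext => j /=; rewrite fsM.
      rewrite e (w_fn wM) // (w_fn wN); last exact: (iso_tuple i tM).
      case: (i) => _ _ ->//; have [y -> My] := @fn_val tau M F t tM.
      by rewrite /= fsM.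
    rewrite (w_fn_out wM) // (w_fn_out wN) ?cvalE /= ?fsc //; first exact: fst.
    by move=> h; apply: ntM => j; exact: fs_inM (tU j) (h j).
  + rewrite -[fsem Ms t]/(fsem_F Ms t) -[LHS]/(fsem_F Ns (fs \o t)).
    have [tD|ntD] := pselect (dom_E E M t).
      have e : fs \o t = f \o t.
        by apply/funext => j /=; rewrite fsM //; exact: (dom_univ kA Esm KM tD).
      by rewrite (val_FE (fst _ _ tU)) (val_FE tU) /= fsv // e.
    rewrite (w_F_out wM) // (w_F_out wN) ?cvalE /= ?fsc //; first exact: fst.
    move=> h; have h' := dom_univ kA Esm KN h.
    have tM : tuple_in (univ M) t by move=> j; exact: fs_inM (tU j) (h' j).
    have e : fs \o t = f \o t by apply/funext => j /=; rewrite fsM.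
    by apply: ntD; apply/(iso_E KM i) => //; rewrite -e.
  + have -> : t = of_void V by apply/funext => -[].
    have -> : fs \o of_void V = of_void V by apply/funext => -[].
    by rewrite -[LHS]/(fsem_c Ns) -[fsem Ms _]/(fsem_c Ms) !cvalE /= fsc.
Qed.

Lemma iso_cval f Ms Ns : model_iso f Ms Ns -> f (cval Ms) = cval Ns.
Proof.
move=> [_ _ h]; have := h (Cstar _) (of_void V).
have -> : f \o of_void V = of_void V by apply/funext => -[].
rewrite -[fsem Ms _]/(fsem_c Ms) -[fsem Ns _]/(fsem_c Ns) !cvalE /=.
by move=> h'; have [] : Some (cval Ns) = Some (f (cval Ms)) by apply: h'; case.
Qed.

Lemma iso_val f Ms Ns a : model_iso f Ms Ns -> tuple_in (univ Ms) a ->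
  f (val_F Ms a) = val_F Ns (f \o a).
Proof.
move=> i aU; case: (i) => [_ _ h]; have := h (Fstar _) a aU.
rewrite -[fsem Ms _]/(fsem_F Ms a) -[fsem Ns _]/(fsem_F Ns (f \o a)) !val_FE //=.
  by case.
exact: (iso_tuple i aU).
Qed.

(** Isomorphisms of extended models respect the predicate for the witness. *)
Lemma iso_ext f Ms Ns M N : model_iso f Ms Ns -> witness k E Ms M ->
  witness k E Ns N -> model_iso f M N.
Proof.
move=> i wM wN; have PE x : univ Ms x -> univ M x <-> univ N (f x).
  move=> Ux; rewrite (w_P wM) (w_P wN) /rsem_P.
  by case: (i) => _ /(_ (Pstar _) (fun=> x)) h _; apply: h.
have sM := w_univ wM; have sN := w_univ wN.
apply: isoI => [x Mx|x y /sM Ux /sM Uy|y Ny|R t tM|F t tM].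
- by apply/PE => //; exact: sM.
- exact: iso_inj i Ux Uy.
- have [x Ux e] := iso_surj i (sN _ Ny); exists x => //.
  by apply/PE => //; rewrite e.
- rewrite -(w_rel wM) -(w_rel wN); case: (i) => _ h _.
  by apply: (h (OldP R)) => j; exact: sM.
- have tN : tuple_in (univ N) (f \o t).
    by move=> j; apply/PE; [exact: sM|exact: tM].
  rewrite -(w_fn wM) // -(w_fn wN) //; case: (i) => _ _ h.
  by apply: (h (OldF F)) => j; exact: sM.
Qed.

(** The witness of an isomorphic copy is the image of the witness, because E is
    invariant. *)
Lemma iso_w f Ms Ns M : model_iso f Ms Ns -> witness k E Ms M ->
  exists2 N, witness k E Ns N & model_iso f M N.
Proof.
move=> i w; have [|N j] := @iso_image _ f M.
  by move=> x y /(w_univ w) Ux /(w_univ w) Uy; exact: iso_inj i Ux Uy.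
exists N => //; have KM := w_K w; have KN := aec_isoK kA j KM.
have [g [gi gf fg]] := iso_inv i; have [g' [gi' gf' fg']] := iso_inv j.
have inN x : univ Ms x -> univ N (f x) <-> univ M x.
  move=> Ux; split=> [Nfx|Mx]; last exact: iso_in Mx.
  have [x' Mx' e] := iso_surj j Nfx.
  by rewrite -(iso_inj i (w_univ w Mx') Ux e).
have back (I : Small) (t : I -> V) : tuple_in (univ Ns) t ->
    exists2 t', tuple_in (univ Ms) t' & t = f \o t'.
  move=> tN; exists (g \o t); first exact: (iso_tuple gi tN).
  by apply/funext => y /=; rewrite fg.
have tMN (I : Small) (t : I -> V) : tuple_in (univ Ms) t ->
    tuple_in (univ N) (f \o t) <-> tuple_in (univ M) t.
  by move=> tU; split=> h y; have := h y => /inN; apply.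
have domN a : tuple_in (univ Ms) a -> dom_E E N (f \o a) <-> dom_E E M a.
  move=> aU; split=> [h|]; last exact: iso_dom.
  have aM : tuple_in (univ M) a by apply/tMN => //; exact: (dom_univ kA Esm KN h).
  exact/(iso_E KM j aM aM).
have sub : univ N `<=` univ Ns.
  move=> y /(iso_surj j)[x /(w_univ w) Ux <-]; exact: iso_in Ux.
have domN' b : dom_E E N b -> exists2 a, dom_E E M a & b = f \o a.
  move=> bD; have /back[a aU e] : tuple_in (univ Ns) b.
    by move=> y; apply: sub; exact: (dom_univ kA Esm KN bD).
  by exists a => //; apply/domN => //; rewrite -e.
case: (i) => _ ri fi.
split=> //.
- apply/seteqP; split=> y.
    move=> /[dup] Ny /sub /(iso_surj i)[x Ux e]; move: Ny; rewrite -e => /inN.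
    rewrite (w_P w) => /(_ Ux) h.
    by apply: (ri (Pstar _) (fun=> x) (fun=> Ux)).1.
  move=> h; have [x Ux e] := iso_surj i (rel_univ h tt); rewrite -e in h *.
  apply/inN => //; rewrite (w_P w).
  by apply: (ri (Pstar _) (fun=> x) (fun=> Ux)).2.
- move=> R t; case: (j) => _ rj _; split=> h.
    have [t' t'U e] := back _ _ (rel_univ h); rewrite e in h *.
    have h' : rsem_old Ms t' := (ri (OldP R) t' t'U).2 h.
    have {}h' := (w_rel w t').1 h'.
    by apply: (rj _ _ _).1 => //; exact: rel_univ h'.
  have tN := rel_univ h; have [t' t'U e] := back _ _ (fun y => sub _ (tN y)).
  rewrite e in h tN *; have t'M := (tMN _ _ t'U).1 tN.
  by apply: (ri (OldP R) t' t'U).1; apply/(w_rel w); exact: (rj _ _ t'M).2.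
- move=> F t tN; have [t' t'U e] := back _ _ (fun y => sub _ (tN y)).
  rewrite e in tN *; have t'M := (tMN _ _ t'U).1 tN.
  case: (j) => _ _ ->//; rewrite -(w_fn w) //.
  exact: (fi (OldF F)).
- move=> F t /back[t' t'U ->] /(tMN _ _ t'U) nM.
  have e := fi (OldF F) t' t'U; rewrite /fsem_old e.
  have -> : @fsem (ext_voc lam tau) Ms (OldF F) t' = fsem_c Ms by exact: (w_fn_out w).
  by rewrite !cvalE /= (iso_cval i).
- move=> c; rewrite cvalE => -[<-]; rewrite -(iso_cval i) => /inN.
  by move=> /(_ (cval_univ _)); exact: w_cval w.
- apply/seteqP; split=> [_ [b /domN'[a aD ->] <-]|_ [y [Uy nNy yc] <-]].
    have aU := w_dom kA Esm w aD; have [Uv nMv vc] := w_val kA Esm w aD.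
    exists (f (val_F Ms a)); last first.
      by rewrite (iso_val i aU) val_FE //; exact: (iso_tuple i aU).
    split; first exact: (iso_in i Uv).
      by move=> /inN; move=> /(_ Uv).
    rewrite cvalE -(iso_cval i) => -[] e; apply: vc.
    by rewrite (iso_inj i (cval_univ _) Uv e).
  have [x Ux e] := iso_surj i Uy; rewrite -e in nNy yc *.
  have [Mx|xc|[a aD va]] := w_cases w Ux.
  + by case: nNy; apply/inN.
  + by case: yc; rewrite cvalE -(iso_cval i) xc.
  + exists (f \o a); first exact/(domN _ (w_dom kA Esm w aD)).
    rewrite -va (iso_val i (w_dom kA Esm w aD)) val_FE //.
    exact: iso_tuple i (w_dom kA Esm w aD).
- move=> _ _ /domN'[a aD ->] /domN'[b bD ->].
  have aU := w_dom kA Esm w aD; have bU := w_dom kA Esm w bD.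
  rewrite !val_FE; [|exact: iso_tuple i _..].
  rewrite -!(iso_val i) // -(iso_E KM j); last 2 first.
  - exact: (dom_univ kA Esm KM aD).
  - exact: (dom_univ kA Esm KM bD).
  have [Ua _ _] := w_val kA Esm w aD; have [Ub _ _] := w_val kA Esm w bD.
  rewrite -(w_val_eq kA Esm w aD bD).
  by split=> [[] /(iso_inj i Ua Ub)//|->].
- move=> b /back[a aU ->] /(domN _ aU) nD.
  have e := fi (Fstar _) a aU; rewrite /fsem_F e.
  have -> : @fsem (ext_voc lam tau) Ms (Fstar _) a = fsem_c Ms by exact: (w_F_out w).
  by rewrite !cvalE /= (iso_cval i).
Qed.

Lemma emb_ext f Ms Ns M N : lek_embedding X f Ms Ns -> witness k E Ms M ->
  witness k E Ns N -> lek_embedding k f M N.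
Proof.
move=> [Ms' i h] wM wN; have [M' wM' j] := iso_w i wM.
by exists M' => //; exact: (lekX h).
Qed.

(** Restrict Ns to the image of f and extend the isomorphism onto it. *)
Lemma ext_emb f Ms Ns M N : lek_embedding k f M N -> witness k E Ms M ->
  witness k E Ns N -> exists fs, [/\ lek_embedding X fs Ms Ns,
    forall x, univ M x -> fs x = f x, fs (cval Ms) = cval Ns
    & forall a, dom_E E M a -> fs (val_F Ms a) = val_F Ns (f \o a)].
Proof.
move=> [M' i h] wM wN; have [Ms' [wM' h']] := ext_restrict laminf kA Esm Esmall wN h.
have [fs [fi fM fc fv]] := ext_iso wM wM' i.
exists fs; split=> //; first by exists Ms'.
  by rewrite fc; exact: (lekX_cval h').
move=> a aD; rewrite fv //; apply: (lekX_val kA Esm h' wM').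
by apply: iso_dom i aD; exact: w_K wM.
Qed.

(** An embedding over M fixes the classes of E_M, so it extends over Ms. *)
Lemma ext_emb_over f Ms Ns Ps M N P : lek X Ms Ns -> lek X Ms Ps ->
  witness k E Ms M -> witness k E Ns N -> witness k E Ps P ->
  lek_embedding k f N P -> (forall x, univ M x -> f x = x) ->
  exists fs, [/\ lek_embedding X fs Ns Ps, forall x, univ N x -> fs x = f x
    & forall x, univ Ms x -> fs x = x].
Proof.
move=> h1 h2 wM wN wP e fid.
have [fs [es fN fc fv]] := ext_emb e wN wP; exists fs; split=> // x.
have sub := lek_univ kA (lekX h1 wM wN).
move=> /(w_cases wM)[Mx|->|[a aD <-]].
- by rewrite fN ?fid //; exact: sub.
- by rewrite (lekX_cval h1) fc -(lekX_cval h1) (lekX_cval h2).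
- rewrite {1}(lekX_val kA Esm h1 wM aD) fv; last first.
    exact: (E_lek Esm (lekX h1 wM wN)).
  rewrite (lekX_val kA Esm h2 wM aD); congr (val_F _ _).
  by apply/funext => j /=; rewrite fid //; exact: (dom_univ kA Esm (w_K wM) aD).
Qed.

End ExtMaps.

(** * Extended models form an abstract elementary class *)

Lemma card_below_le (mu : option Small) T U (A : set T) (B : set U) :
  A #<= B -> card_below mu B -> card_below mu A.
Proof.
case: mu => [m AB [Bm mB]|AB [k]] /=.
  split; first exact: card_le_trans AB Bm.
  by move=> mA; apply: mB; exact: card_le_trans mA AB.
rewrite card_eq_le => /andP[/(card_le_trans AB)/card_leRP[R [R1 R2 R3 R4]] _].
exists {x : k | exists a, R a x}; rewrite card_eq_le; apply/andP; split.
  apply: (@card_leR _ _ _ _ (fun a x => R a (proj1_sig x))).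
    move=> a /R2[x ax]; by exists (exist _ x (ex_intro _ a ax)).
  by move=> a a' [x ?] _ _; exact: R4.
apply: (@card_leR _ _ _ _ (fun x a => R a (proj1_sig x))).
  by move=> [x [a ax]] _; exists a => //; case: (R1 _ _ ax).
move=> [x hx] [x' hx'] a _ _ /= ax ax'; have e := R3 _ _ _ ax ax'; subst x'.
by rewrite (Prop_irrelevance hx hx').
Qed.

Section Chains.
Variables (tau : vocabulary) (k : aec tau) (lam : Small) (mu : option Small).
Hypothesis kA : ess_aec k lam mu.
Variables (I : Small) (lt : I -> I -> Prop) (Mi : I -> model tau).
Hypothesis ltI : limit_order lt.
Hypothesis Minc : increasing k lt Mi.

Lemma increasing_inK i : inK k (Mi i).
Proof.
by have [j ij] := lo_nolast ltI i; case: (aec_leK kA (Minc ij)).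
Qed.

Lemma limit_below i : limit_at lt i ->
  limit_order (fun x y : {j | lt j i} => lt (proj1_sig x) (proj1_sig y)).
Proof.
move=> [[j ji] dense]; split.
- exact: wf_inverse_image (lo_wf ltI).
- by move=> x y z; exact: (lo_trans ltI).
- move=> [x xi] [y yi] /=; have [h|e|h] := lo_total ltI x y.
  + exact: Or31.
  + by subst y; rewrite (Prop_irrelevance xi yi); exact: Or32.
  + exact: Or33.
- by exists (exist _ j ji).
- by move=> [x xi]; have [y xy yi] := dense _ xi; exists (exist _ y yi).
Qed.

(** Inserting the union of the earlier models at every limit stage turns an
    increasing chain into a continuous one below it. *)
Lemma continuous_refinement M : is_union k setT Mi M ->
  exists Mc, (forall i, lek k (Mc i) (Mi i)) /\ inc_cont k lt Mc M.
Proof.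
move=> [KM UM Mle].
have union_at i : limit_at lt i ->
    exists2 N, is_union k [set j | lt j i] Mi N & lek k N (Mi i).
  move=> li; have ltJ := limit_below li.
  pose Mj (x : {j | lt j i}) := Mi (proj1_sig x).
  have incj : increasing k (fun x y : {j | lt j i} => lt (proj1_sig x) (proj1_sig y)) Mj.
    by move=> x y xy; exact: Minc.
  have [|N [UN _]] := aec_union kA ltJ incj.
    apply: card_below_le (aec_card kA KM).2; apply: subset_card_le.
    by move=> x [[j ji] _ Mx]; rewrite UM; exists j.
  exists N; last by apply: (aec_union_le kA ltJ incj UN) => -[j ji]; exact: Minc.
  case: UN => KN eN leN; split=> //; last first.
    by move=> j ji; exact: (leN (exist _ j ji) Logic.I).
  rewrite eN; apply/seteqP; split=> [x [[j ji] _ Mx]|x [j ji Mx]]; first by exists j.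
  by exists (exist _ j ji).
have /choice[Mc McP] : forall i, exists N,
    (limit_at lt i -> is_union k [set j | lt j i] Mi N) /\ lek k N (Mi i) /\
    (~ limit_at lt i -> N = Mi i).
  move=> i; have [li|nli] := pselect (limit_at lt i).
    by have [N h1 h2] := union_at _ li; exists N.
  exists (Mi i); split=> //; split=> //; apply: (aec_refl kA).
  exact: increasing_inK.
have Mcle i : lek k (Mc i) (Mi i) by case: (McP i) => _ [].
have leMc i j : lt i j -> lek k (Mi i) (Mc j).
  move=> ij; have [h [_ h']] := McP j; have [lj|nlj] := pselect (limit_at lt j).
    by case: (h lj) => _ _; apply.
  by rewrite h' //; exact: Minc.
exists Mc; split=> //; split=> [i j ij|i li|].
- exact: (aec_trans kA (Mcle i) (leMc _ _ ij)).
- have [/(_ li)[KN UN leN] _] := McP i; split=> //; last first.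
    by move=> j ji; exact: (aec_trans kA (Mcle j) (leN _ ji)).
  rewrite UN; apply/seteqP; split=> x [j /= ji Mx].
    have [l jl Il] := li.2 _ ji; exists l => //.
    exact: (lek_univ kA (leMc _ _ jl) Mx).
  by exists j => //; exact: (lek_univ kA (Mcle j) Mx).
- split=> //; last by move=> i _; exact: (aec_trans kA (Mcle i) (Mle i Logic.I)).
  rewrite UM; apply/seteqP; split=> x [j /= _ Mx].
    have [l jl] := lo_nolast ltI j; exists l => //.
    exact: (lek_univ kA (leMc _ _ jl) Mx).
  by exists j => //; exact: (lek_univ kA (Mcle j) Mx).
Qed.

End Chains.

Section ExtAec.
Variables (lam : Small) (mu : option Small) (tau : vocabulary) (k : aec tau).
Variable E : seq_relation lam tau.
Hypothesis laminf : infinite_set [set: lam].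
Hypothesis kA : ess_aec k lam mu.
Hypothesis Esm : smooth k E.
Hypothesis Esmall : small_E k E.
Implicit Types (M N : model tau) (Ms Ns : model (ext_voc lam tau)).
Implicit Types (f : V -> V) (a b : lam -> V).
Let X := ext_aec k E.

Lemma ext_union_w (I : Small) (J : set I) (Msi : I -> model (ext_voc lam tau))
    (Mi : I -> model tau) Ms M :
  (forall i, J i -> witness k E (Msi i) (Mi i)) -> witness k E Ms M ->
  is_union X J Msi Ms -> is_union k J Mi M.
Proof.
move=> wi w [_ U le].
have lei i : J i -> lek k (Mi i) M by move=> Ji; exact: (lekX (le _ Ji) (wi _ Ji) w).
split=> //; first exact: w_K w.
apply/seteqP; split=> [x Mx|x [i Ji]]; last exact: (lek_univ kA (lei _ Ji)).
have := w_univ w Mx; rewrite U => -[i Ji Ux]; exists i => //.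
apply: (w_inter kA Esm (wi _ Ji) w (lei _ Ji) _ _ Ux Mx).
  exact: (lekX_cval (le _ Ji)).
by move=> a aD; exact: (lekX_val kA Esm (le _ Ji) (wi _ Ji) aD).
Qed.

(** Smoothness speaks of continuous chains; the refinement reduces to them. *)
Lemma E_union (I : Small) (lt : I -> I -> Prop) (Mi : I -> model tau) M a :
  limit_order lt -> increasing k lt Mi -> is_union k setT Mi M ->
  dom_E E M a -> exists i b, dom_E E (Mi i) b /\ E M a b.
Proof.
move=> ltI Minc /(continuous_refinement kA ltI Minc)[Mc [Mcle Mcc]] aD.
have [i [b [bD ab]]] := sm_cont Esm ltI Mcc aD.
by exists i, b; split=> //; exact: (E_lek Esm (Mcle i) bD).
Qed.

Lemma ext_eq Ms Ns M : witness k E Ms M -> witness k E Ns M ->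
  cval Ms = cval Ns -> (forall a, dom_E E M a -> val_F Ms a = val_F Ns a) ->
  Ms = Ns.
Proof.
move=> w1 w2 ec ev; have MM := aec_refl kA (w_K w1).
apply: submodel_anti; first exact: (ext_submodel kA Esm w1 w2).
by apply: (ext_submodel kA Esm w2 w1) => // a /ev.
Qed.

Lemma lekX_eq Ms Ns M : lek X Ms Ns -> witness k E Ms M -> witness k E Ns M ->
  Ms = Ns.
Proof.
move=> h w1 w2; apply: (ext_eq w1 w2); first exact: (lekX_cval h).
by move=> a aD; exact: (lekX_val kA Esm h w1 aD).
Qed.

Section Union.
Variables (I : Small) (lt : I -> I -> Prop) (Msi : I -> model (ext_voc lam tau)).
Hypothesis ltI : limit_order lt.
Hypothesis Msinc : increasing X lt Msi.

Lemma increasing_w : exists Mi, (forall i, witness k E (Msi i) (Mi i)) /\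
  increasing k lt Mi.
Proof.
have /choice[Mi wi] : forall i, exists M, witness k E (Msi i) M.
  by move=> i; have [j /Msinc[_ [M [N [? _ _]]]]] := lo_nolast ltI i; exists M.
by exists Mi; split=> // i j /Msinc h; exact: (lekX h).
Qed.

(** An extended model above a chain has no freedom at the classes over the
    union of the chain, as they have representatives inside. *)
Lemma union_val Ms Ns M N : is_union X setT Msi Ms ->
  (forall i, lek X (Msi i) Ns) -> witness k E Ms M -> witness k E Ns N ->
  lek k M N -> cval Ms = cval Ns /\
    forall a, dom_E E M a -> val_F Ms a = val_F Ns a.
Proof.
move=> Us leN wM wN MN; have [Mi [wi Minc]] := increasing_w.
have U := ext_union_w (fun i _ => wi i) wM Us.
case: (Us) => _ _ leM; split.
  have [i _] := lo_nonempty ltI.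
  by rewrite -(lekX_cval (leM i Logic.I)) (lekX_cval (leN i)).
move=> a aD; have [i [b [bD ab]]] := E_union ltI Minc U aD.
have bDM := dom_E_r Esm (w_K wM) ab.
rewrite ((w_val_eq kA Esm wM aD bDM).2 ab).
rewrite -(lekX_val kA Esm (leM i Logic.I) (wi i) bD).
rewrite (lekX_val kA Esm (leN i) (wi i) bD).
apply/esym/(w_val_eq kA Esm wN); [exact: (E_lek Esm MN aD)| |exact: (E_lek Esm MN ab)].
exact: (E_lek Esm MN bDM).
Qed.

(** The union interprets the function on a tuple in the chain as the members of
    the chain do; these agree because any two are comparable. *)
Lemma ext_union : card_below mu (\bigcup_i univ (Msi i)) ->
  exists! Ms, is_union X setT Msi Ms.
Proof.
move=> cU; have [Mi [wi Minc]] := increasing_w.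
have [|M [UM Muniq]] := aec_union kA ltI Minc.
  apply: card_below_le cU; apply: subset_card_le => x [i _ /(w_univ (wi i)) Ux].
  by exists i.
case: (UM) => KM eM leM.
have dir i j : exists l, [/\ lek X (Msi i) (Msi l), lek X (Msi j) (Msi l),
    lek k (Mi i) (Mi l) & lek k (Mi j) (Mi l)].
  have refl l : lek X (Msi l) (Msi l).
    split; first exact: submodel_refl.
    by exists (Mi l), (Mi l); split=> //; apply: (aec_refl kA); exact: w_K (wi l).
  have [l [h1 h2]] : exists l, lek X (Msi i) (Msi l) /\ lek X (Msi j) (Msi l).
    by have [h|->|h] := lo_total ltI i j; [exists j|exists j|exists i]; split=> //;
      exact: Msinc.
  by exists l; split=> //; [exact: (lekX h1)|exact: (lekX h2)].
have [i0 _] := lo_nonempty ltI.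
have cE i : cval (Msi i) = cval (Msi i0).
  by have [l [h1 h2 _ _]] := dir i i0; rewrite (lekX_cval h1) (lekX_cval h2).
have vE i j a : dom_E E (Mi i) a -> dom_E E (Mi j) a ->
    val_F (Msi i) a = val_F (Msi j) a.
  move=> ai aj; have [l [h1 h2 _ _]] := dir i j.
  by rewrite (lekX_val kA Esm h1 (wi i) ai) (lekX_val kA Esm h2 (wi j) aj).
have /choice[psi psiE] : forall a, exists y, forall i, dom_E E (Mi i) a ->
    y = val_F (Msi i) a.
  move=> a; have [[i ai]|n] := pselect (exists i, dom_E E (Mi i) a).
    by exists (val_F (Msi i) a) => j; exact: vE.
  by exists V0 => i ai; case: n; exists i.
have [|||||Ms [w ec ev]] := @ext_exists _ _ _ _ E kA Esm Esmall M (cval (Msi i0))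
    [set a | exists i, dom_E E (Mi i) a] psi KM.
- by rewrite eM => -[i _]; rewrite -(cE i); exact: w_cval (wi i).
- by move=> a [i ai]; exact: (E_lek Esm (leM i Logic.I) ai).
- move=> a [i ai]; split; last first.
    by rewrite (psiE _ _ ai) -(cE i); case: (w_val kA Esm (wi i) ai).
  rewrite eM => -[j _ Mj]; have [l [h1 h2 h3 h4]] := dir i j.
  have al := E_lek Esm h3 ai; have [_ + _] := w_val kA Esm (wi l) al; apply.
  by rewrite -(psiE _ _ al); exact: (lek_univ kA h4 Mj).
- move=> a b [i ai] [j bj]; have [l [h1 h2 h3 h4]] := dir i j.
  have al := E_lek Esm h3 ai; have bl := E_lek Esm h4 bj.
  rewrite (psiE _ _ al) (psiE _ _ bl) (w_val_eq kA Esm (wi l) al bl).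
  split; first exact: (E_lek Esm (leM l Logic.I)).
  have Kl := w_K (wi l).
  by apply: (E_lek_back kA Esm (leM l Logic.I)); exact: (dom_univ kA Esm Kl).
- apply: small_set_le (card_below_small cU); apply: subset_card_le.
  move=> _ [a [i ai] <-]; exists i => //; rewrite (psiE _ _ ai).
  by case: (w_val kA Esm (wi i) ai).
have leMs i : lek X (Msi i) Ms.
  apply: (lekXI kA Esm (wi i) w (leM i Logic.I)); first by rewrite cE.
  by move=> a ai; rewrite ev ?(psiE _ _ ai) //; exists i.
have UMs : is_union X setT Msi Ms.
  split=> //; first by exists M.
  apply/seteqP; split=> [x|x [i _]]; last by case: (leMs i) => -[+ _ _] _; apply.
  move=> /(w_cases w)[|->|[a aD <-]].
  - by rewrite eM => -[i _ Mx]; exists i => //; exact: (w_univ (wi i)).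
  - by rewrite ec; exists i0 => //; exact: cval_univ.
  - have [i [b [bi ab]]] := E_union ltI Minc UM aD; exists i => //.
    rewrite ((w_val_eq kA Esm w aD (dom_E_r Esm KM ab)).2 ab) ev; last by exists i.
    by rewrite (psiE _ _ bi); case: (w_val kA Esm (wi i) bi).
exists Ms; split=> // Ns UNs; case: (UNs) => -[N wN] _ leNs.
have e : M = N by apply: Muniq; exact: (ext_union_w _ wN UNs).
rewrite -e in wN.
have [ecN evN] := union_val UMs (fun i => leNs i Logic.I) w wN (aec_refl kA KM).
exact: ext_eq evN.
Qed.

End Union.

(** A new element of A is captured by putting into M a representative of its
    class, which costs at most lam elements. *)
Lemma ext_LS (A : set V) Ns : inK X Ns -> A `<=` univ Ns ->
  exists Ms, [/\ A `<=` univ Ms, lek X Ms Ns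
               & univ Ms #<= [set: (lam + set_type A)%type]].
Proof.
move=> [N w] AN; have KN := w_K w.
have /choice[r rP] : forall y, exists a, (exists2 a, dom_E E N a & val_F Ns a = y) ->
    dom_E E N a /\ val_F Ns a = y.
  move=> y; have [[a aD ay]|] := pselect (exists2 a, dom_E E N a & val_F Ns a = y).
    by exists a.
  by exists (fun=> V0).
pose B := [set x | A x /\ univ N x] `|`
  [set x | exists y i, [/\ A y, dom_E E N (r y) & r y i = x]].
have BN : B `<=` univ N.
  move=> x [[]//|[y [i [_ rD <-]]]]; exact: (dom_univ kA Esm KN rD).
have [M [BM MN Mle]] := aec_LS kA KN BN.
have [Ms [wM h]] := ext_restrict laminf kA Esm Esmall w MN.
exists Ms; split=> //.
  move=> y Ay; have [Ny|->|ex] := w_cases w (AN _ Ay).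
  - by apply: (w_univ wM); apply: BM; left.
  - by rewrite -(lekX_cval h); exact: cval_univ.
  - have [rD ry] := rP _ ex.
    have rM : dom_E E M (r y).
      have rM : tuple_in (univ M) (r y) by move=> i; apply: BM; right; exists y, i.
      exact: (E_lek_back kA Esm MN rM rM rD).
    by rewrite -ry -(lekX_val kA Esm h wM rM); case: (w_val kA Esm wM rM).
set C := [set: (lam + set_type A)%type].
have lamC : [set: lam] #<= C.
  by apply: (@card_le_fun _ _ _ _ inl) => // x y _ _ [].
have AC : A #<= C.
  apply: (@card_leR _ _ _ _ (fun x c => exists Ax : A x,
      c = inr (SigSub (mem_set Ax)))).
    by move=> x Ax; exists (inr (SigSub (mem_set Ax))) => //; exists Ax.
  by move=> x x' _ _ _ [Ax ->] [Ax' []].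
have Cinf : infinite_set C.
  by apply/infiniteP; apply: card_le_trans lamC; exact/infiniteP.
have BC : B #<= C.
  apply: (card_leU Cinf).
    by apply: card_le_trans AC; apply: subset_card_le => x [].
  apply: (@card_le_trans _ _ _ (A `*` [set: lam])); last first.
    by apply: card_le_trans (card_square Cinf); exact: card_leX.
  apply: (@card_le_trans _ _ _ ((fun p => r p.1 p.2) @` (A `*` [set: lam]))).
    by apply: subset_card_le => _ [y [i [Ay _ <-]]]; exists (y, i).
  exact: card_image_le.
apply: (@card_le_trans _ _ _ (univ M)).
  by have := w_card laminf kA Esm Esmall wM; rewrite card_eq_le => /andP[].
apply: card_le_trans Mle _.
apply: (@card_le_trans _ _ _ ((inl @` [set: lam]) `|` (inr @` [set: set_type B]))).
  by apply: subset_card_le => -[x|x] _; [left|right]; exists x.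
apply: (card_leU Cinf).
  by apply: card_le_trans lamC; exact: card_image_le.
apply: card_le_trans (card_image_le _ _) _; apply: card_le_trans BC.
by apply: (@card_le_fun _ _ _ _ set_val) => [x _|x y _ _ /val_inj//]; exact: set_valP.
Qed.

Lemma ext_aec_ess : ess_aec X lam mu.
Proof.
split.
- move=> [R|]; first exact: (aec_par kA R).
  have [g [_ _]] := infinite_seq laminf.
  by apply: (@card_le_fun _ _ _ _ (fun=> g 0)) => // -[] [].
- move=> [F||]; [exact: (aec_far kA F)|exact: card_lexx|].
  have [g [_ _]] := infinite_seq laminf.
  by apply: (@card_le_fun _ _ _ _ (fun=> g 0)) => // -[].
- by move=> Ms Ns [_ [M [N [wM wN _]]]]; split; [exists M|exists N].
- by move=> Ms Ns [].
- by move=> f Ms Ns i [M w]; have [N wN _] := iso_w kA Esm i w; exists N.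
- move=> f M1 M2 N1 N2 [sub [M1' [M2' [w1 w2 le]]]] i2 i1 sub'.
  have [N1' v1 j1] := iso_w kA Esm i1 w1; have [N2' v2 j2] := iso_w kA Esm i2 w2.
  split=> //; exists N1', N2'; split=> //.
  by apply: (aec_isole kA le j2 j1); exact: (iso_submodel j2 j1 (aec_sub kA le)).
- move=> Ms [M w]; have [h1 h2] := aec_card kA (w_K w); split.
    by apply: card_le_trans h1 _; apply: subset_card_le; exact: w_univ w.
  apply: card_below_le h2.
  by have := w_card laminf kA Esm Esmall w; rewrite card_eq_le => /andP[].
- move=> Ms [M w]; split; first exact: submodel_refl.
  by exists M, M; split=> //; exact: (aec_refl kA (w_K w)).
- move=> M1 M2 M3 h12 h23; split.
    exact: submodel_trans (lekX_sub h12) (lekX_sub h23).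
  have [N1 [N2 [w1 w2 le]]] := lekX_w h12.
  have [_ [N3 [_ w3 _]]] := lekX_w h23; exists N1, N3; split=> //.
  exact: (aec_trans kA le (lekX h23 w2 w3)).
- by move=> Ms Ns /lekX_sub h1 /lekX_sub h2; exact: submodel_anti.
- exact: ext_union.
- move=> I lt Msi Ms Ns ltI inc U leN; case: (U) => -[M wM] _ leM.
  have [i0 _] := lo_nonempty ltI; have [_ [N [_ wN _]]] := lekX_w (leN i0).
  have [Mi [wi Minc]] := increasing_w ltI inc.
  have UM := ext_union_w (fun i _ => wi i) wM U.
  have MN : lek k M N.
    by apply: (aec_union_le kA ltI Minc UM) => i; exact: (lekX (leN i)).
  have [ec ev] := union_val ltI inc U leN wM wN MN.
  exact: (lekXI kA Esm wM wN).
- move=> M1 M2 Ns sub h1 h2; split=> //.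
  have [N1 [N [w1 w le1]]] := lekX_w h1; have [N2 [_ [w2 _ _]]] := lekX_w h2.
  have le2 := lekX h2 w2 w; exists N1, N2; split=> //.
  apply: (lek_coherence kA le1 le2) => x Nx.
  apply: (w_inter kA Esm w2 w le2 (lekX_cval h2) _ _ (lek_univ kA le1 Nx)).
    by move=> a; exact: (lekX_val kA Esm h2 w2).
  by case: sub => + _ _; apply; exact: (w_univ w1).
- exact: ext_LS.
Qed.

End ExtAec.

(** * The frame of extended models *)

Lemma iso_class_eq (tau : vocabulary) (M N : model tau) :
  [set P | isomorphic M P] = [set P | isomorphic N P] <-> isomorphic M N.
Proof.
split=> [e|[f i]].
  have : [set P | isomorphic N P] N by exists id; exact: iso_id.
  by rewrite -e.
have [g [gi _ _]] := iso_inv i.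
by apply/seteqP; split=> P [h hi]; eexists; [exact: iso_comp gi hi|exact: iso_comp i hi].
Qed.

Section ExtFrame.
Variables (lam : Small) (mu : option Small) (tau : vocabulary) (s : frame tau).
Variable E : seq_relation lam tau.
Hypothesis laminf : infinite_set [set: lam].
Hypothesis sG : good_frame s lam mu.
Hypothesis Esm : smooth s E.
Hypothesis Esmall : small_E s E.
Implicit Types (M N : model tau) (Ms Ns : model (ext_voc lam tau)).
Implicit Types (f : V -> V).
Let kA := gf_aec sG.
Let kAP := gf_ap sG.
Let X := ext_aec s E.
Let XA : ess_aec X lam mu := ext_aec_ess laminf kA Esm Esmall.
Let T := ext_frame s E.

Lemma ext_ap : amalgamation X.
Proof.
move=> Ms0 Ms1 Ms2 h1 h2; have [M0 [M1 [w0 w1 le1]]] := lekX_w h1.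
have [_ [M2 [_ w2 _]]] := lekX_w h2; have le2 := lekX h2 w0 w2.
have [N [f1 [f2 [e1 e2 e]]]] := kAP le1 le2.
have [|Ns wN] := @ext_any _ _ _ _ _ kA Esm Esmall N.
  by case: e1 => ? _ /(aec_leK kA)[].
have [g1 [i1 gM1 gc1 gv1]] := ext_emb laminf kA Esm Esmall e1 w1 wN.
have [g2 [i2 gM2 gc2 gv2]] := ext_emb laminf kA Esm Esmall e2 w2 wN.
exists Ns, g1, g2; split=> // x /(w_cases w0)[Mx|->|[a aD <-]].
- by rewrite gM1 ?gM2 ?e //; [exact: (lek_univ kA le2)|exact: (lek_univ kA le1)].
- by rewrite {1}(lekX_cval h1) (lekX_cval h2) gc1 gc2.
- rewrite {1}(lekX_val kA Esm h1 w0 aD) (lekX_val kA Esm h2 w0 aD).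
  rewrite gv1 ?gv2; [|exact: (E_lek Esm le2)|exact: (E_lek Esm le1)].
  congr (val_F _ _); apply/funext => j /=; rewrite e //.
  exact: (dom_univ kA Esm (w_K w0) aD).
Qed.

Lemma ext_jep : joint_embedding X.
Proof.
move=> Ms1 Ms2 [M1 w1] [M2 w2].
have [N [f1 [f2 [e1 e2]]]] := gf_jep sG (w_K w1) (w_K w2).
have [|Ns wN] := @ext_any _ _ _ _ _ kA Esm Esmall N.
  by case: e1 => ? _ /(aec_leK kA)[].
have [g1 [i1 _ _ _]] := ext_emb laminf kA Esm Esmall e1 w1 wN.
have [g2 [i2 _ _ _]] := ext_emb laminf kA Esm Esmall e2 w2 wN.
by exists Ns, g1, g2.
Qed.

(** If f maps N into M, then f (f x) = f x for x in N, so x = f x is in M. *)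
Lemma ltk_iso_id f M N N' : ltk s M N -> model_iso f N N' ->
  (forall x, univ M x -> f x = x) -> M <> N'.
Proof.
move=> [MN ne] i fid e; apply: ne; apply: (lek_eq kA MN) => x Nx.
have Mfx : univ M (f x) by rewrite e; exact: iso_in Nx.
rewrite -(iso_inj i (lek_univ kA MN Mfx) Nx) //; exact: fid.
Qed.

Lemma ext_ltk Ms M N : witness s E Ms M -> ltk s M N ->
  exists N' Ns h, [/\ model_iso h N N', witness s E Ns N' & ltk X Ms Ns].
Proof.
move=> w lt; have [N' [Ns [h [hi wN MN' le hid]]]] :=
  ext_extend laminf kA Esm Esmall w lt.1.
exists N', Ns, h; split=> //; split=> // e.
rewrite -e in wN; apply: (ltk_iso_id lt hi hid).
exact: (witness_unique w wN).
Qed.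

Lemma ext_nomax : no_maximal X.
Proof.
move=> Ms [M w]; have [N lt] := gf_nomax sG (w_K w).
by have [_ [Ns [_ [_ _ h]]]] := ext_ltk w lt; exists Ns.
Qed.

Lemma ext_isomorphic Ms Ns M N : witness s E Ms M -> witness s E Ns N ->
  isomorphic Ms Ns <-> isomorphic M N.
Proof.
move=> wM wN; split=> [[f i]|[f i]]; first by exists f; exact: (iso_ext i wM wN).
by have [g [gi _ _ _]] := ext_iso kA Esm wM wN i; exists g.
Qed.

Lemma ext_K_card (chi : Small) Ms M : witness s E Ms M ->
  K_card X chi Ms <-> K_card s chi M.
Proof.
move=> w; have e := w_card laminf kA Esm Esmall w.
split=> -[_ h]; split; [exact: w_K w| |by exists M|].
  by apply: card_eq_trans h; rewrite card_eq_sym.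
exact: card_eq_trans h.
Qed.

Lemma ext_iso_classes (kappa : Small) : iso_classes X kappa #= iso_classes s kappa.
Proof.
pose S C D := exists Ms M, [/\ witness s E Ms M, C = [set Ns | isomorphic Ms Ns]
  & D = [set N | isomorphic M N]].
have SE C C' D D' : S C D -> S C' D' -> C = C' <-> D = D'.
  move=> [Ms [M [w -> ->]]] [Ms' [M' [w' -> ->]]].
  by rewrite !iso_class_eq (ext_isomorphic w w').
rewrite card_eq_le; apply/andP; split.
  apply: (@card_leR _ _ _ _ S) => [C [Ms KMs ->]|C C' D _ _ h h'].
    have [[M w] _] := KMs; exists [set N | isomorphic M N]; last by exists Ms, M.
    by exists M => //; exact/(ext_K_card _ w).
  by apply/(SE _ _ _ _ h h').
apply: (@card_leR _ _ _ _ (fun D C => S C D)) => [D [M KM ->]|D D' C _ _ h h'].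
  have [Ms w] := ext_any kA Esm Esmall KM.1.
  exists [set Ns | isomorphic Ms Ns]; last by exists Ms, M.
  by exists Ms => //; exact/(ext_K_card _ w).
by apply/(SE _ _ _ _ h h').
Qed.

(** Both conditions speak of models up to isomorphism, and chains and unions of
    extended models are chains and unions of the witnesses. *)
Lemma ext_superlimit (chi : Small) Ms M : witness s E Ms M ->
  superlimit s chi M -> superlimit X chi Ms.
Proof.
move=> w [KM slu slU]; split.
- exact/(ext_K_card _ w).
- move=> Ms1 K1; have [[M1 w1] _] := K1.
  have [M2 [i2 lt K2]] := slu _ ((ext_K_card _ w1).1 K1).
  have [N [Ns [h [hi wN ltX]]]] := ext_ltk w1 lt; exists Ns; split=> //.
    apply/(ext_isomorphic wN w); have [g [gi _ _]] := iso_inv hi.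
    by case: i2 => f fi; exists (f \o g); exact: iso_comp gi fi.
  apply/(ext_K_card _ wN); split; first exact: w_K wN.
  by apply: card_eq_trans K2.2; exact: iso_card hi.
- move=> I lt Msi Ns ltI Ichi inc isoi U; have [Mi [wi Minc]] := increasing_w ltI inc.
  case: (U) => -[N wN] _ _; have UM := ext_union_w kA Esm (fun i _ => wi i) wN U.
  apply/(ext_isomorphic wN w); apply: slU ltI Ichi Minc _ UM => i.
  by apply/(ext_isomorphic (wi i) w).
Qed.

(** The types over Ms of elements of the witnesses are the types over M: an
    amalgam of extended models restricts to the witnesses, and an amalgam of the
    witnesses over M, moved off Ms, carries the extended models. *)
Lemma ext_ortp Ms N1s N2s M N1 N2 a1 a2 :
  lek X Ms N1s -> lek X Ms N2s -> witness s E Ms M ->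
  witness s E N1s N1 -> witness s E N2s N2 -> univ N1 a1 -> univ N2 a2 ->
  ortp X a1 Ms N1s = ortp X a2 Ms N2s <-> ortp s a1 M N1 = ortp s a2 M N2.
Proof.
move=> h1 h2 w w1 w2 a1N a2N; have [l1 l2] := (lekX h1 w w1, lekX h2 w w2).
have [a1Ns a2Ns] := (w_univ w1 a1N, w_univ w2 a2N).
have sub := w_univ w.
rewrite (ortp_eqP XA ext_ap h1 a1Ns h2 a2Ns) (ortp_eqP kA kAP l1 a1N l2 a2N).
split=> -[_ _ _ [P [f1 [f2 [e1 e2 i1 i2 e]]]]].
  have [P0 wP] : inK X P by case: e1 => ? _ /(aec_leK XA)[].
  apply: (at_relI (N := P0) (f1 := f1) (f2 := f2)) => //.
  - exact: (emb_ext kA Esm e1 w1 wP).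
  - exact: (emb_ext kA Esm e2 w2 wP).
  - by move=> x /sub; exact: i1.
  - by move=> x /sub; exact: i2.
have MP := emb_lek_id kA l1 e1 i1.
have [P' [Ps [h [hi wP MP' hle hid]]]] := ext_extend laminf kA Esm Esmall w MP.
have he : lek_embedding s h P P'.
  by apply: (emb_iso kA _ hi); case: (aec_leK kA MP).
have [|g1 [j1 gN1 gM1]] := ext_emb_over laminf kA Esm Esmall h1 hle w w1 wP (emb_comp kA e1 he).
  by move=> x Mx /=; rewrite i1 // hid.
have [|g2 [j2 gN2 gM2]] := ext_emb_over laminf kA Esm Esmall h2 hle w w2 wP (emb_comp kA e2 he).
  by move=> x Mx /=; rewrite i2 // hid.
apply: (at_relI (N := Ps) (f1 := g1) (f2 := g2)) => //.
by rewrite gN1 // gN2 //= e.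
Qed.

(** Both triples embed in some P, and the witness of P decides membership. *)
Lemma ext_ortp_mem Ms N1s N2s N1 N2 a1 a2 :
  lek X Ms N1s -> lek X Ms N2s ->
  witness s E N1s N1 -> witness s E N2s N2 -> univ N1 a1 -> univ N2s a2 ->
  ortp X a1 Ms N1s = ortp X a2 Ms N2s -> univ N2 a2.
Proof.
move=> h1 h2 w1 w2 a1N a2N; have a1Ns := w_univ w1 a1N.
move/(ortp_eqP XA ext_ap h1 a1Ns h2 a2N).
move=> [_ _ _ [P [f1 [f2 [e1 [Q i2 QP] _ _ e]]]]].
have [P0 wP] : inK X P by case: e1 => ? _ /(aec_leK XA)[].
have [Q0 wQ j2] := iso_w kA Esm i2 w2.
have P0a : univ P0 (f2 a2).
  by rewrite -e; exact: (emb_in kA (emb_ext kA Esm e1 w1 wP) a1N).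
have Q0a : univ Q0 (f2 a2).
  apply: (w_inter kA Esm wQ wP (lekX QP wQ wP) (lekX_cval QP) _ _ P0a).
    by move=> a; exact: (lekX_val kA Esm QP wQ).
  exact: iso_in i2 a2N.
have [x Nx ex] := iso_surj j2 Q0a.
by rewrite -(iso_inj i2 (w_univ w2 Nx) a2N ex).
Qed.

Lemma ext_bsP Ms Ns M N a : lek X Ms Ns -> witness s E Ms M ->
  witness s E Ns N -> univ Ns a ->
  bs T Ms (ortp X a Ms Ns) <-> univ N a /\ bs s M (ortp s a M N).
Proof.
move=> h wM wN Na; have MN := lekX h wM wN; split.
  move=> [Ps [M' [P [b [h' [wM' wP MP] [Pb nMb] bsb e]]]]].
  have eM := witness_unique wM' wM; rewrite eM in MP nMb bsb.
  have Na' : univ N a := ext_ortp_mem h' h wP wN Pb Na (esym e).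
  split=> //; have -> // : ortp s a M N = ortp s b M P.
  by apply/(ext_ortp h h').
move=> [Na' bsa]; exists Ns, M, N, a; split=> //.
by split=> //; exact: (gf_bs_nonalg sG MN Na' bsa).
Qed.

Lemma ext_bs_ortp Ms M p : witness s E Ms M -> bs T Ms p ->
  exists Ns N a, [/\ lek X Ms Ns, witness s E Ns N, univ N a,
    p = ortp X a Ms Ns & bs s M (ortp s a M N)].
Proof.
move=> w [Ns [M' [N [a [h [wM' wN _] [Na _] bsa ->]]]]].
have e := witness_unique wM' w; rewrite e in bsa.
by exists Ns, N, a.
Qed.

Lemma ext_nfP Ms0 Ms1 Ms3 M0 M1 M3 a : lek X Ms0 Ms1 -> lek X Ms1 Ms3 ->
  witness s E Ms0 M0 -> witness s E Ms1 M1 -> witness s E Ms3 M3 ->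
  nf T Ms0 Ms1 a Ms3 <-> nf s M0 M1 a M3.
Proof.
move=> h01 h13 w0 w1 w3; split=> [[_ _ [M0' [M1' [M3' [w0' w1' w3' h]]]]]|h].
  have e0 := witness_unique w0' w0; have e1 := witness_unique w1' w1.
  by have e3 := witness_unique w3' w3; subst.
by split=> //; exists M0, M1, M3.
Qed.

Lemma ext_dnf_mem Ms Ns Ms0 N a : lek X Ms Ns -> witness s E Ns N ->
  univ Ns a -> dnf T (ortp X a Ms Ns) Ms Ms0 -> univ N a.
Proof.
move=> h wN Na [Ns' [a' [h' _ e [_ _ [M0 [M1 [M3 [_ w1 w3 nfa]]]]]]]].
have [_ [Ma _] _ _] := gf_nf_dom sG nfa.
exact: (ext_ortp_mem h' h w3 wN Ma Na (esym e)).
Qed.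

Lemma ext_dnfP Ms Ns Ms0 M N M0 a : lek X Ms0 Ms -> lek X Ms Ns ->
  witness s E Ms0 M0 -> witness s E Ms M -> witness s E Ns N -> univ N a ->
  dnf T (ortp X a Ms Ns) Ms Ms0 <-> dnf s (ortp s a M N) M M0.
Proof.
move=> h0 h w0 w wN Na; have MN := lekX h w wN.
rewrite (dnf_ortp sG _ MN Na); split=> [|nfa].
  move=> [Ns' [a' [h' _ e nfa']]]; have [_ [N' [_ w' _]]] := lekX_w h'.
  have {}nfa' := (ext_nfP a' h0 h' w0 w w').1 nfa'.
  have [_ [Na' _] _ _] := gf_nf_dom sG nfa'.
  by apply: (nf_ortp sG nfa' MN Na); apply/(ext_ortp h' h w).
exists Ns, a; split=> //; first exact: (w_univ wN).
exact/(ext_nfP a h0 h w0 w wN).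
Qed.

Lemma ext_inc_cont (I : Small) (lt : I -> I -> Prop)
    (Msi : I -> model (ext_voc lam tau)) Ms M : limit_order lt ->
  inc_cont X lt Msi Ms -> witness s E Ms M ->
  exists Mi, [/\ forall i, witness s E (Msi i) (Mi i), inc_cont s lt Mi M
    & forall i, lek X (Msi i) Ms].
Proof.
move=> ltI [inc cont U] w; have [Mi [wi Minc]] := increasing_w ltI inc.
exists Mi; split=> // [|i]; last by case: U => _ _; apply.
split=> // [i li|]; last exact: (ext_union_w kA Esm (fun i _ => wi i) w U).
exact: (ext_union_w kA Esm (fun j _ => wi j) (wi i) (cont i li)).
Qed.

Lemma ext_bs_stable Ms : inK X Ms -> bs T Ms #<= univ Ms.
Proof.
move=> [M w]; apply: (@card_le_trans _ _ _ (univ M)); last first.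
  by apply: subset_card_le; exact: w_univ w.
apply: card_le_trans (gf_bs_stable sG (w_K w)).
apply: (@card_leR _ _ _ _ (fun p q => exists Ns N a,
  [/\ lek X Ms Ns, witness s E Ns N, univ N a, p = ortp X a Ms Ns
    & q = ortp s a M N])).
  move=> p /(ext_bs_ortp w)[Ns [N [a [h wN Na -> bsa]]]].
  by exists (ortp s a M N) => //; exists Ns, N, a.
move=> p p' q _ _ [Ns [N [a [h wN Na -> ->]]]] [Ns' [N' [a' [h' wN' Na' ->]]]].
by move=> /(ext_ortp h h' w wN wN' Na Na').
Qed.

(** The models that symmetry of s provides above M3 are moved away from the new
    elements of Ms3.  The larger one is expanded first, and the expansion of the
    smaller one is its restriction. *)
Lemma ext_symmetry Ms0 Ms3 a1 a2 : lek X Ms0 Ms3 ->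
  univ Ms3 a1 -> univ Ms3 a2 ->
  bs T Ms0 (ortp X a1 Ms0 Ms3) -> bs T Ms0 (ortp X a2 Ms0 Ms3) ->
  (exists Ms1 Ms3', [/\ lek X Ms0 Ms1 /\ lek X Ms1 Ms3', univ Ms1 a1,
                        lek X Ms3 Ms3' & nf T Ms0 Ms1 a2 Ms3']) ->
  (exists Ms2 Ms3', [/\ lek X Ms0 Ms2 /\ lek X Ms2 Ms3', univ Ms2 a2,
                        lek X Ms3 Ms3' & nf T Ms0 Ms2 a1 Ms3']).
Proof.
move=> h03; have [M0 [M3 [w0 w3 le03]]] := lekX_w h03.
move=> Ma1 Ma2 /(ext_bsP h03 w0 w3 Ma1)[{}Ma1 bs1].
move=> /(ext_bsP h03 w0 w3 Ma2)[{}Ma2 bs2].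
move=> [Ms1 [Ms3' [[h01 h13'] M1a1 h33' nf2]]].
have [_ [M1 [_ w1 _]]] := lekX_w h01.
have [_ [M3' [_ w3' _]]] := lekX_w h33'.
have le01 := lekX h01 w0 w1; have le13' := lekX h13' w1 w3'.
have le33' := lekX h33' w3 w3'.
have {}M1a1 : univ M1 a1.
  apply: (w_inter kA Esm w1 w3' le13' (lekX_cval h13') _ M1a1).
    by move=> a; exact: (lekX_val kA Esm h13' w1).
  exact: (lek_univ kA le33').
have {}nf2 := (ext_nfP a2 h01 h13' w0 w1 w3').1 nf2.
have [[M2 [N [[le02 le2N] M2a2 le3N nf1]]] _] :
    (exists M2 N, [/\ lek s M0 M2 /\ lek s M2 N, univ M2 a2,
       lek s M3 N & nf s M0 M2 a1 N]) /\ True.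
  by split=> //; apply/(gf_symmetry sG le03 Ma1 Ma2 bs1 bs2); exists M1, M3'.
have [N' [Ns [h [hi wN le3N' h3N hid]]]] := ext_extend laminf kA Esm Esmall w3 le3N.
have [M2' hi2 le2N'] := lek_iso kA le2N hi.
have sub03 := lek_univ kA le03.
have hi0 : model_iso h M0 M0.
  by apply: iso_eq (iso_id _) => x Mx; rewrite hid //; exact: sub03.
have le02' : lek s M0 M2'.
  apply: (lek_iso_id kA le02 hi2) => x Mx; rewrite hid //; exact: sub03.
have [Ms2 [w2 h2N]] := ext_restrict laminf kA Esm Esmall wN le2N'.
have h0N : lek X Ms0 Ns := aec_trans XA h03 h3N.
have h02 : lek X Ms0 Ms2.
  apply: (lekXI kA Esm w0 w2 le02'); first by rewrite (lekX_cval h0N) (lekX_cval h2N).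
  move=> a aD; rewrite (lekX_val kA Esm h0N w0 aD) (lekX_val kA Esm h2N w2) //.
  exact: (E_lek Esm le02').
exists Ms2, Ns; split=> //.
  by apply: (w_univ w2); rewrite -(hid _ Ma2); exact: iso_in M2a2.
apply/(ext_nfP a1 h02 h2N w0 w2 wN); rewrite -(hid _ Ma1).
exact: (gf_nf_iso sG le02' le2N' hi hi0 hi2 nf1).
Qed.

(** A realization of the extension in some N2 above N is moved away from the new
    elements of Ns. *)
Lemma ext_existence Ms Ns p : lek X Ms Ns -> bs T Ms p ->
  exists q, [/\ bs T Ns q, restr X q Ms = p & dnf T q Ns Ms].
Proof.
move=> h; have [M [N [w wN MN]]] := lekX_w h.
move=> /(ext_bs_ortp w)[N1s [N1 [a [h1 w1 Na -> bsa]]]].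
have [q [bsq rq dq]] := gf_existence sG MN bsa.
have [N2 [b [NN2 Nb qE]]] := gf_bs_types sG (w_K wN) bsq.
have [N2' [N2s [g [gi w2 NN2' h2 gid]]]] := ext_extend laminf kA Esm Esmall wN NN2.
have N2gb : univ N2' (g b) := iso_in gi Nb.
have KN2 : inK s N2 by case: (aec_leK kA NN2).
have qE' : q = ortp s (g b) N N2'.
  by rewrite qE; exact: (ortp_emb kA kAP NN2 Nb (emb_iso kA KN2 gi) gid).
have Nsgb := w_univ w2 N2gb.
exists (ortp X (g b) Ns N2s); split.
- by apply/(ext_bsP h2 wN w2 Nsgb); rewrite -qE'.
- rewrite (restr_ortp XA ext_ap h h2 Nsgb).
  have hM2 : lek X Ms N2s := aec_trans XA h h2.
  apply/(ext_ortp hM2 h1 w w2 w1 N2gb Na).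
  by rewrite -rq qE' (restr_ortp kA kAP MN NN2' N2gb).
- by apply/(ext_dnfP h h2 w wN w2 N2gb); rewrite -qE'.
Qed.

Lemma ext_uniqueness Ms0 Ms1 p q : lek X Ms0 Ms1 ->
  bs T Ms1 p -> bs T Ms1 q -> dnf T p Ms1 Ms0 -> dnf T q Ms1 Ms0 ->
  restr X p Ms0 = restr X q Ms0 -> p = q.
Proof.
move=> h; have [M0 [M1 [w0 w1 le]]] := lekX_w h.
move=> /(ext_bs_ortp w1)[Ns [N [a [hN wN Na -> bsa]]]].
move=> /(ext_bs_ortp w1)[Ps [P [b [hP wP Pb -> bsb]]]].
move=> /(ext_dnfP h hN w0 w1 wN Na) da /(ext_dnfP h hP w0 w1 wP Pb) db.
have [Nsa Psb] := (w_univ wN Na, w_univ wP Pb).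
rewrite (restr_ortp XA ext_ap h hN Nsa) (restr_ortp XA ext_ap h hP Psb).
have h0N : lek X Ms0 Ns := aec_trans XA h hN.
have h0P : lek X Ms0 Ps := aec_trans XA h hP.
move=> /(ext_ortp h0N h0P w0 wN wP Na Pb) e; apply/(ext_ortp hN hP w1 wN wP Na Pb).
apply: (gf_uniqueness sG le bsa bsb da db).
have [l1 l2] := (lekX hN w1 wN, lekX hP w1 wP).
by rewrite (restr_ortp kA kAP le l1 Na) (restr_ortp kA kAP le l2 Pb).
Qed.

Lemma ext_local_character (I : Small) (lt : I -> I -> Prop)
    (Msi : I -> model (ext_voc lam tau)) Ms p :
  limit_order lt -> inc_cont X lt Msi Ms -> bs T Ms p ->
  exists i, dnf T p Ms (Msi i).
Proof.
move=> ltI ic bsp; have [M w] : inK X Ms by case: ic => _ _ [].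
have [Mi [wi icM le]] := ext_inc_cont ltI ic w.
have [Ns [N [a [h wN Na -> bsa]]]] := ext_bs_ortp w bsp.
have [i di] := gf_local_character sG ltI icM bsa; exists i.
exact/(ext_dnfP (le i) h (wi i) w wN Na).
Qed.

(** Non-forking of a restriction puts the realization a into the witness, where
    continuity of s applies. *)
Lemma ext_continuity (I : Small) (lt : I -> I -> Prop)
    (Msi : I -> model (ext_voc lam tau)) Ms i0 p :
  limit_order lt -> inc_cont X lt Msi Ms -> least lt i0 ->
  orbital_types X Ms p ->
  (forall i, dnf T (restr X p (Msi i)) (Msi i) (Msi i0)) ->
  bs T Ms p /\ dnf T p Ms (Msi i0).
Proof.
move=> ltI ic least0 [Ns [a [h Nsa ->]]] di.
have [M [N [w wN MN]]] := lekX_w h; have [Mi [wi icM le]] := ext_inc_cont ltI ic w.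
have hi i : lek X (Msi i) Ns := aec_trans XA (le i) h.
have Na : univ N a.
  have := di i0; rewrite (restr_ortp XA ext_ap (le i0) h Nsa).
  exact: ext_dnf_mem (hi i0) wN Nsa.
have le0 i : lek X (Msi i0) (Msi i).
  have [/least0//|->|h0] := lo_total ltI i i0.
    by apply: (aec_refl XA); exists (Mi i0).
  by case: ic => inc _ _; exact: inc.
have [||bsa da] := gf_continuity (p := ortp s a M N) sG ltI icM least0.
- by exists N, a.
- move=> i; have := di i; rewrite (restr_ortp XA ext_ap (le i) h Nsa).
  rewrite (restr_ortp kA kAP (lekX (le i) (wi i) w) MN Na).
  by move=> /(ext_dnfP (le0 i) (hi i) (wi i0) (wi i) wN Na).
split; first exact/(ext_bsP h w wN Nsa).
exact/(ext_dnfP (le i0) h (wi i0) w wN Na).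
Qed.

Lemma ext_monotonicity Ms0 Ms0' Ms1' Ms1 Ms3 Ms3' Ms3'' a :
  lek X Ms0 Ms0' -> lek X Ms0' Ms1' -> lek X Ms1' Ms1 ->
  lek X Ms1 Ms3 -> lek X Ms3 Ms3' ->
  univ Ms1 `|` [set a] `<=` univ Ms3'' -> lek X Ms3'' Ms3' ->
  (nf T Ms0 Ms1 a Ms3 -> nf T Ms0' Ms1' a Ms3') /\
  (nf T Ms0' Ms1' a Ms3' <-> nf T Ms0' Ms1' a Ms3'').
Proof.
move=> h00' h01' h11 h13 h33 sub h3''.
have [M0 [M0' [w0 w0' _]]] := lekX_w h00'; have le00' := lekX h00' w0 w0'.
have [_ [M1' [_ w1' _]]] := lekX_w h01'; have le01' := lekX h01' w0' w1'.
have [_ [M1 [_ w1 _]]] := lekX_w h11; have le11 := lekX h11 w1' w1.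
have [_ [M3 [_ w3 _]]] := lekX_w h13; have le13 := lekX h13 w1 w3.
have [_ [M3' [_ w3' _]]] := lekX_w h33; have le33 := lekX h33 w3 w3'.
have [M3'' [_ [w3'' _ _]]] := lekX_w h3''; have le3'' := lekX h3'' w3'' w3'.
have subM1 : univ M1 `<=` univ M3''.
  move=> x Mx; apply: (w_inter kA Esm w3'' w3' le3'' (lekX_cval h3'')).
  - by move=> b; exact: (lekX_val kA Esm h3'' w3'').
  - by apply: sub; left; exact: (w_univ w1).
  - exact: (lek_univ kA le33 (lek_univ kA le13 Mx)).
have h13' : lek X Ms1 Ms3' := aec_trans XA h13 h33.
have h1'3' : lek X Ms1' Ms3' := aec_trans XA h11 h13'.
have h1'3'' : lek X Ms1' Ms3''.
  apply: (lek_coherence XA h1'3' h3'') => x /(lek_univ XA h11) Ux.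
  by apply: sub; left.
rewrite (ext_nfP a h01' h1'3' w0' w1' w3') (ext_nfP a h01' h1'3'' w0' w1' w3'').
have h01 : lek X Ms0 Ms1 := aec_trans XA h00' (aec_trans XA h01' h11).
rewrite (ext_nfP a h01 h13 w0 w1 w3).
have mono (P : model tau) : univ M1 `|` [set a] `<=` univ P -> lek s P M3' ->
    (nf s M0 M1 a M3 -> nf s M0' M1' a M3') /\
    (nf s M0' M1' a M3' <-> nf s M0' M1' a P).
  by move=> h1 h2; exact: (gf_monotonicity sG le00' le01' le11 le13 le33 h1 h2).
have r3 : lek s M3' M3' := aec_refl kA (w_K w3').
have key : univ M3' a -> (nf s M0' M1' a M3' <-> nf s M0' M1' a M3'').
  move=> Ma; have Ma'' : univ M3'' a.
    apply: (w_inter kA Esm w3'' w3' le3'' (lekX_cval h3'')) => //.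
      by move=> b; exact: (lekX_val kA Esm h3'' w3'').
    by apply: sub; right.
  by have [|//] := mono M3'' _ le3''; move=> x [/subM1//|->].
split=> [n|].
  have [_ [Ma _] _ _] := gf_nf_dom sG n.
  have [|+ _] := mono M3' _ r3; last exact.
  move=> x [Mx|->]; last exact: (lek_univ kA le33).
  exact: (lek_univ kA le33 (lek_univ kA le13 Mx)).
split=> n; have [_ [Ma _] _ _] := gf_nf_dom sG n; first exact/key.
by apply/key => //; exact: (lek_univ kA le3'').
Qed.

Theorem ext_good : good_frame T lam mu.
Proof.
split.
- exact: XA.
- move=> chi lchi muchi; have [M sl] := gf_superlimit sG lchi muchi.
  have [Ms w] := ext_any kA Esm Esmall (sl_card sl).1.
  by exists Ms; exact: ext_superlimit w sl.
- apply: card_le_trans (gf_few sG).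
  by have := ext_iso_classes lam; rewrite card_eq_le => /andP[].
- exact: ext_ap.
- exact: ext_jep.
- exact: ext_nomax.
- move=> Ms [M w] p /(ext_bs_ortp w)[Ns [N [a [h wN Na -> _]]]].
  by exists Ns, a; split=> //; exact: (w_univ wN).
- move=> f Ms Ns Ms' Ns' a h h' Na i j.
  have [M [N [w wN MN]]] := lekX_w h; have [M' [N' [w' wN' MN']]] := lekX_w h'.
  move=> /(ext_bsP h w wN Na)[Na' bsa].
  have [iN iM] := (iso_ext i wN wN', iso_ext j w w').
  apply/(ext_bsP h' w' wN'); first exact: iso_in i Na.
  split; first exact: iso_in iN Na'.
  exact: (gf_bs_iso sG MN MN' Na' iN iM bsa).
- move=> Ms Ns a h Na; have [M [N [w wN MN]]] := lekX_w h.
  move=> /(ext_bsP h w wN Na)[Na' bsa] Ma.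
  apply: (gf_bs_nonalg sG MN Na' bsa).
  apply: (w_inter kA Esm w wN MN (lekX_cval h) _ Ma Na').
  by move=> b; exact: (lekX_val kA Esm h w).
- move=> Ms Ns h ne; have [M [N [w wN MN]]] := lekX_w h.
  have [|a [Na nMa bsa]] := gf_bs_density sG MN.
    by move=> e; rewrite -e in wN; apply: ne; exact: (lekX_eq kA Esm h w wN).
  have Nsa := w_univ wN Na; exists a; split=> //; last exact/(ext_bsP h w wN Nsa).
  move=> Ma; apply: nMa; apply: (w_inter kA Esm w wN MN (lekX_cval h) _ Ma Na).
  by move=> b; exact: (lekX_val kA Esm h w).
- exact: ext_bs_stable.
- move=> f Ms0 Ms1 a Ms3 Ms0' Ms1' Ms3' h01 h13 i3 i0 i1.
  move=> [_ _ [M0 [M1 [M3 [w0 w1 w3 n]]]]].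
  have [M0' [M1' [w0' w1' le01]]] := lekX_w h01.
  have [_ [M3' [_ w3' _]]] := lekX_w h13; have le13 := lekX h13 w1' w3'.
  apply/(ext_nfP _ h01 h13 w0' w1' w3').
  exact: (gf_nf_iso sG le01 le13 (iso_ext i3 w3 w3') (iso_ext i0 w0 w0')
    (iso_ext i1 w1 w1') n).
- move=> Ms0 Ms1 a Ms3 [h01 h13 [M0 [M1 [M3 [w0 w1 w3 n]]]]].
  have [[le01 le13] [Ma nMa] bs0 bs1] := gf_nf_dom sG n.
  have Msa := w_univ w3 Ma; have h03 : lek X Ms0 Ms3 := aec_trans XA h01 h13.
  split=> //; [split=> //|exact/(ext_bsP h03 w0 w3 Msa)|exact/(ext_bsP h13 w1 w3 Msa)].
  move=> Msa'; apply: nMa; apply: (w_inter kA Esm w1 w3 le13 (lekX_cval h13) _ Msa' Ma).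
  by move=> b; exact: (lekX_val kA Esm h13 w1).
- move=> Ms0 a Ms3 h Msa; have [M0 [M3 [w0 w3 le]]] := lekX_w h.
  have r : lek X Ms0 Ms0 by apply: (aec_refl XA); exists M0.
  rewrite (ext_nfP a r h w0 w0 w3) (ext_bsP h w0 w3 Msa); split=> [n|[Ma bsa]].
    have [_ [Ma _] _ _] := gf_nf_dom sG n; split=> //.
    exact/(gf_nf_bs sG le Ma).
  exact/(gf_nf_bs sG le Ma).
- exact: ext_monotonicity.
- exact: ext_local_character.
- move=> Ms0 Ms0' Ms0'' Ms3 a h01 h12 h23 _.
  have [M0 [M1 [w0 w1 le01]]] := lekX_w h01.
  have [_ [M2 [_ w2 _]]] := lekX_w h12; have le12 := lekX h12 w1 w2.
  have [_ [M3 [_ w3 _]]] := lekX_w h23; have le23 := lekX h23 w2 w3.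
  have h13 : lek X Ms0' Ms3 := aec_trans XA h12 h23.
  have h02 : lek X Ms0 Ms0'' := aec_trans XA h01 h12.
  move=> /(ext_nfP a h12 h23 w1 w2 w3) n1 /(ext_nfP a h01 h13 w0 w1 w3) n2.
  apply/(ext_nfP a h02 h23 w0 w2 w3).
  have [_ [Ma _] _ _] := gf_nf_dom sG n1.
  exact: (gf_transitivity sG le01 le12 le23 Ma n1 n2).
- exact: ext_uniqueness.
- move=> Ms0 Ms3 a1 a2 h Ma1 Ma2 bs1 bs2.
  by split; exact: ext_symmetry.
- exact: ext_existence.
- exact: ext_continuity.
Qed.

(** A test extension of M need not fit above Ms, so it is moved and the embedding
    obtained is composed with the inverse move. *)
Lemma ext_prime Ms Ns M N a : lek X Ms Ns -> witness s E Ms M ->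
  witness s E Ns N -> univ N a -> prime_triple T Ms Ns a <-> prime_triple s M N a.
Proof.
move=> h w wN Na; have MN := lekX h w wN; have Nsa := w_univ wN Na; split.
  move=> [_ _ /(ext_bsP h w wN Nsa)[_ bsa] pr]; split=> // N' a' MN' Na' e.
  have [P [Ps [g [gi wP MP hP gid]]]] := ext_extend laminf kA Esm Esmall w MN'.
  have Pga : univ P (g a') := iso_in gi Na'; have Psga := w_univ wP Pga.
  have KN' : inK s N' by case: (aec_leK kA MN').
  have [|f [fe fid fa]] := pr _ _ hP Psga.
    apply/(ext_ortp hP h w wP wN Pga Na); rewrite -e.
    by rewrite (ortp_emb kA kAP MN' Na' (emb_iso kA KN' gi) gid).
  have [g' [gi' g'g gg']] := iso_inv gi; have KP := w_K wP.
  exists (g' \o f); split=> [|x Mx|] /=.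
  - exact: (emb_comp kA (emb_ext kA Esm fe wN wP) (emb_iso kA KP gi')).
  - rewrite fid; last exact: (w_univ w).
    by rewrite -{1}(gid _ Mx) g'g //; exact: (lek_univ kA MN').
  - by rewrite fa g'g.
move=> [_ _ bsa pr]; split=> //; first exact/(ext_bsP h w wN Nsa).
move=> Ns' a' h' Nsa' e; have [_ [N' [_ w' _]]] := lekX_w h'.
have MN' := lekX h' w w'.
have Na' : univ N' a' := ext_ortp_mem h h' wN w' Na Nsa' (esym e).
have [|f [fe fid fa]] := pr _ _ MN' Na'; first exact/(ext_ortp h' h w w' wN Na' Na).
have [fs [fse fsN fsid]] := ext_emb_over laminf kA Esm Esmall h h' w wN w' fe fid.
by exists fs; split=> //; rewrite fsN.
Qed.

Lemma ext_has_primes : has_primes s -> has_primes T.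
Proof.
move=> pr Ms p [M w] /(ext_bs_ortp w)[Ns [N [a [h wN Na -> bsa]]]].
have [P [b [prb e]]] := pr _ _ (w_K w) bsa; have [MP Pb _ _] := prb.
have [P' [Ps [g [gi wP MP' hP gid]]]] := ext_extend laminf kA Esm Esmall w MP.
have KP : inK s P by case: (aec_leK kA MP).
have Pgb : univ P' (g b) := iso_in gi Pb.
have eg : ortp s b M P = ortp s (g b) M P' :=
  ortp_emb kA kAP MP Pb (emb_iso kA KP gi) gid.
exists Ps, (g b); split; last by apply/(ext_ortp hP h w wP wN Pgb Na); rewrite -eg.
apply/(ext_prime hP w wP Pgb); case: prb => _ _ bsb prb; split=> //.
  by rewrite -eg.
move=> N' a' MN' Na'; rewrite -eg => /(prb _ _ MN' Na')[f [fe fid fb]].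
have [g' [gi' g'g gg']] := iso_inv gi; have KP' := w_K wP.
exists (f \o g'); split=> [|x Mx|] /=.
- exact: (emb_comp kA (emb_iso kA KP' gi') fe).
- by rewrite -{1}(gid _ Mx) g'g ?fid //; exact: (lek_univ kA MP).
- by rewrite g'g.
Qed.

Lemma ext_nf_extension Ms Ns Ps Qs M N P Q a b : lek X Ms Ns -> lek X Ms Ps ->
  lek X Ps Qs -> witness s E Ms M -> witness s E Ns N -> witness s E Ps P ->
  witness s E Qs Q -> univ N a -> univ Q b ->
  nf_extension T Ms (ortp X a Ms Ns) Ps (ortp X b Ps Qs) ->
  nf_extension s M (ortp s a M N) P (ortp s b P Q).
Proof.
move=> hN hP hQ w wN wP wQ Na Qb; have Qsb := w_univ wQ Qb.
move=> [/(ext_bsP hQ wP wQ Qsb)[_ bsb] + /(ext_dnfP hP hQ w wP wQ Qb) db].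
rewrite (restr_ortp XA ext_ap hP hQ Qsb).
have hMQ : lek X Ms Qs := aec_trans XA hP hQ.
move=> /(ext_ortp hMQ hN w wQ wN Qb Na) e; split=> //.
by rewrite (restr_ortp kA kAP (lekX hP w wP) (lekX hQ wP wQ) Qb).
Qed.

(** Prime triples over Ms restrict to prime triples over M, so there are no more
    tests for weak orthogonality over Ms than over M. *)
Lemma ext_weakly_orthogonal Ms Ns1 Ns2 M N1 N2 a1 a2 :
  lek X Ms Ns1 -> lek X Ms Ns2 -> witness s E Ms M ->
  witness s E Ns1 N1 -> witness s E Ns2 N2 -> univ N1 a1 -> univ N2 a2 ->
  weakly_orthogonal s M (ortp s a1 M N1) (ortp s a2 M N2) ->
  weakly_orthogonal T Ms (ortp X a1 Ms Ns1) (ortp X a2 Ms Ns2).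
Proof.
move=> hN1 hN2 w wN1 wN2 Na1 Na2 wo Ms1 Ms2 Ms3 b1 b2 h01 h13 h02 h23 p1 p2 e1 e2.
have [_ [M1 [_ w1 _]]] := lekX_w h01; have [_ [M2 [_ w2 _]]] := lekX_w h02.
have [_ [M3 [_ w3 _]]] := lekX_w h13.
have [_ Mb1 _ _] := p1; have [_ Mb2 _ _] := p2.
have {}Mb1 : univ M1 b1 := ext_ortp_mem hN1 h01 wN1 w1 Na1 Mb1 (esym e1).
have {}Mb2 : univ M2 b2 := ext_ortp_mem hN2 h02 wN2 w2 Na2 Mb2 (esym e2).
apply/(ext_nfP b2 h01 h13 w w1 w3).
apply: (wo M1 M2 M3 b1 b2 (lekX h01 w w1) (lekX h13 w1 w3) (lekX h02 w w2)
  (lekX h23 w2 w3)).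
- exact/(ext_prime h01 w w1 Mb1).
- exact/(ext_prime h02 w w2 Mb2).
- exact/(ext_ortp h01 hN1 w w1 wN1 Mb1 Na1).
- exact/(ext_ortp h02 hN2 w w2 wN2 Mb2 Na2).
Qed.

Lemma ext_regular Ms Ns M N c : lek X Ms Ns -> witness s E Ms M ->
  witness s E Ns N -> univ N c -> regular_type s M (ortp s c M N) ->
  regular_type T Ms (ortp X c Ms Ns).
Proof.
move=> h w wN Nc [bsc reg]; split; first exact/(ext_bsP h w wN (w_univ wN Nc)).
move=> Ps q hP bsq; have [_ [P [_ wP _]]] := lekX_w hP; have MP := lekX hP w wP.
have [Qs [Q [b [hQ wQ Qb -> bsb]]]] := ext_bs_ortp wP bsq.
have PQ := lekX hQ wP wQ; have hMQ : lek X Ms Qs := aec_trans XA hP hQ.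
rewrite (restr_ortp XA ext_ap hP hQ (w_univ wQ Qb)).
move=> /(ext_ortp hMQ h w wQ wN Qb Nc) e nd.
have orth : orthogonal_types s M (ortp s c M N) P (ortp s b P Q).
  apply: reg => //; first by rewrite (restr_ortp kA kAP MP PQ Qb).
  by move=> /(ext_dnfP hP hQ w wP wQ Qb).
move=> Rs q1 q2 hMR hPR n1 n2; have [_ [R [_ wR _]]] := lekX_w hMR.
have [b1 _ _] := n1; have [b2 _ _] := n2.
have [Qs1 [Q1 [c1 [hQ1 wQ1 Qc1 e1 _]]]] := ext_bs_ortp wR b1.
have [Qs2 [Q2 [c2 [hQ2 wQ2 Qc2 e2 _]]]] := ext_bs_ortp wR b2.
rewrite e1 e2 in n1 n2 *.
apply: (ext_weakly_orthogonal hQ1 hQ2 wR wQ1 wQ2 Qc1 Qc2).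
apply: (orth R _ _ (lekX hMR w wR) (lekX hPR wP wR)).
  exact: ext_nf_extension h hMR hQ1 w wN wR wQ1 Nc Qc1 n1.
exact: ext_nf_extension hQ hPR hQ2 wP wQ wR wQ2 Qb Qc2 n2.
Qed.

Lemma ext_has_regulars : has_regulars s -> has_regulars T.
Proof.
move=> reg Ms Ns h ne; have [M [N [w wN MN]]] := lekX_w h.
have [|c [Nc nMc rc]] := reg _ _ MN.
  by move=> e; rewrite -e in wN; apply: ne; exact: (lekX_eq kA Esm h w wN).
exists c; split; first exact: (w_univ wN).
  move=> Mc; apply: nMc; apply: (w_inter kA Esm w wN MN (lekX_cval h) _ Mc Nc).
  by move=> b; exact: (lekX_val kA Esm h w).
exact: ext_regular h w wN Nc rc.
Qed.

End ExtFrame.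

Theorem claim2p16 (lam : Small) (mu : option Small) (tau : vocabulary)
    (s : frame tau) (E : seq_relation lam tau)
    (lam_infinite : infinite_set [set: lam])
    (lam_mu : card_below mu [set: lam])
    (s_good : good_frame s lam mu)
    (E_smooth : smooth s E)
    (E_small : small_E s E) :
  [/\ good_frame (ext_frame s E) lam mu,
      forall kappa : Small,
        iso_classes (ext_frame s E) kappa #= iso_classes s kappa,
      has_primes s -> has_primes (ext_frame s E)
    & has_regulars s -> has_regulars (ext_frame s E)].
Proof.
split.
- exact: (ext_good lam_infinite s_good E_smooth E_small).
- by move=> kappa; exact: (ext_iso_classes lam_infinite s_good E_smooth E_small).
- exact: (ext_has_primes lam_infinite s_good E_smooth E_small).
- exact: (ext_has_regulars lam_infinite s_good E_smooth E_small).
Qed.
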